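(* Let $p$ and $q$ be distinct odd primes and let $E_{p,q}: y^2=x^3-pqx$, with $2$-isogenous curve $\widehat{E_{p,q}}: y^2=x^3+4pqx$, $2$-isogeny $\phi:E_{p,q}\to\widehat{E_{p,q}}$ and dual isogeny $\widehat\phi$. Then $$S^{(\phi)}(E_{p,q}/\mathbb{Q})=\{1,pq\}\quad\text{and}\quad S^{(\widehat\phi)}(\widehat{E_{p,q}}/\mathbb{Q})=\{1,-pq\}$$ (as subsets of $\mathbb{Q}^*/(\mathbb{Q}^* )^2$) if and only if one of the following conditions holds: (i) $p\equiv 1 \pmod 4$, $q\equiv 1\pmod 4$, $pq\equiv 13\pmod{16}$ and $\left(\frac{p}{q}\right)=-1$; (ii) $p\not\equiv q\pmod 4$, $pq\equiv 3\pmod 8$ and $\left(\frac{p}{q}\right)=-1$; (iii) $p\equiv q\equiv 3\pmod 4$, $\left(\frac{p}{q}\right)=1$, $q\equiv 3\pmod 8$, and $p-q\equiv 8$ or $12\pmod{16}$; (iv) $p\equiv q\equiv 3\pmod 4$, $\left(\frac{p}{q}\right)=-1$, $p\equiv 3\pmod 8$, and $q-p\equiv 8$ or $12\pmod{16}$.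
   Context: $\left(\frac{\cdot}{\cdot}\right)$ is the Legendre symbol. The isogeny $\phi$ is given by $\phi(x,y)=\left(\frac{y^2}{x^2},\frac{y(x^2+pq)}{x^2}\right)$ for $x\neq 0$ and $\phi(0,0)=\phi(O)=O$. Let $S=\{\infty,2,p,q\}$ and let $\mathbb{Q}(S,2)=\{d\in\mathbb{Q}^*/(\mathbb{Q}^* )^2:\operatorname{ord}_\ell(d)\equiv 0\pmod 2\text{ for all primes }\ell\notin S\}$, which is represented by $\{\pm1,\pm2,\pm p,\pm q,\pm2p,\pm2q,\pm pq,\pm2pq\}$. The Selmer groups are $$S^{(\phi)}(E_{p,q}/\mathbb{Q})=\{d\in\mathbb{Q}(S,2): w^2=du^4+\tfrac{4pq}{d}z^4 \text{ has a solution } (u,w,z)\ne(0,0,0) \text{ in } \mathbb{Q}_v \text{ for all } v\in S\},$$ $$S^{(\widehat\phi)}(\widehat{E_{p,q}}/\mathbb{Q})=\{d\in\mathbb{Q}(S,2): w^2=du^4-\tfrac{16pq}{d}z^4 \text{ has a solution } (u,w,z)\ne(0,0,0) \text{ in } \mathbb{Q}_v \text{ for all } v\in S\},$$ where $\mathbb{Q}_\infty=\mathbb{R}$. These are the usual Selmer groups attached to the isogenies $\phi$ and $\widehat\phi$, viewed inside $\mathbb{Q}^*/(\mathbb{Q}^* )^2$. *)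

(* Defs.v *)
From HB Require Import structures.
From mathcomp Require Import all_boot all_order all_algebra.
From mathcomp Require Import generic_quotient ring_quotient.
From mathcomp Require Import mathcomp_extra boolp classical_sets functions reals.
From mathcomp Require Import ring lra zify.

Set Implicit Arguments.
Unset Strict Implicit.
Unset Printing Implicit Defensive.

Import Order.TTheory GRing.Theory Num.Theory.

Local Open Scope ring_scope.
Local Open Scope quotient_scope.
Local Open Scope classical_set_scope.

Definition prime_nat := {l : nat | prime l}.

(* Junk value: [ordq l 0 = 0]. *)
Definition ordq (l : nat) (x : rat) : int :=
  (logn l `|numq x|%N)%:Z - (logn l `|denq x|%N)%:Z.

Definition padic_norm (l : nat) (x : rat) : rat :=
  if x == 0 then 0 else l%:R ^ (- ordq l x).

Section PadicNorm.
Variable l : nat.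
Hypothesis l_prime : prime l.
Implicit Types x y : rat.

Lemma ordq_frac (a b : int) : a != 0 -> b != 0 ->
  ordq l (a%:Q / b%:Q) = (logn l `|a|%N)%:Z - (logn l `|b|%N)%:Z.
Proof.
move=> a0 b0; set x := a%:Q / b%:Q.
have x0 : x != 0 by rewrite mulf_neq0 ?invr_eq0 ?intr_eq0.
have E : numq x * b = a * denq x.
  apply/eqP; rewrite -(eqr_int rat) !intrM numqE /x.
  by apply/eqP; field; rewrite intr_eq0.
have n0 : numq x != 0 by rewrite numq_eq0.
have := congr1 (fun z : int => logn l `|z|%N) E.
rewrite !abszM !lognM ?absz_gt0 ?denq_neq0 // /ordq.
by move: (logn l _) (logn l _) (logn l _) (logn l _) => *; lia.
Qed.

Lemma ordqM x y : x != 0 -> y != 0 -> ordq l (x * y) = ordq l x + ordq l y.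
Proof.
move=> x0 y0.
have -> : x * y = (numq x * numq y)%:Q / (denq x * denq y)%:Q.
  rewrite -{1}[x]divq_num_den -{1}[y]divq_num_den !intrM.
  by field; rewrite !intr_eq0 !denq_neq0.
rewrite ordq_frac ?mulf_neq0 ?denq_neq0 ?numq_eq0 // /ordq.
rewrite !abszM !lognM ?absz_gt0 ?denq_neq0 ?numq_eq0 //; lia.
Qed.

Lemma lognD_min (a b : int) : a != 0 -> b != 0 -> a + b != 0 ->
  (minn (logn l `|a|) (logn l `|b|) <= logn l (absz (a + b)%R))%N.
Proof.
move=> a0 b0 ab0.
rewrite -pfactor_dvdn ?absz_gt0 //.
set k := minn _ _.
have Ha : (l ^ k %| `|a|)%N by rewrite pfactor_dvdn ?absz_gt0 // geq_minl.
have Hb : (l ^ k %| `|b|)%N by rewrite pfactor_dvdn ?absz_gt0 // geq_minr.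
suff : ((l ^ k)%:Z %| a + b)%Z by rewrite dvdzE.
by apply: rpredD; rewrite /dvdz /= ?inE dvdzE.
Qed.

Lemma ordqD_min x y : x != 0 -> y != 0 -> x + y != 0 ->
  Num.min (ordq l x) (ordq l y) <= ordq l (x + y).
Proof.
move=> x0 y0 xy0.
have E : x + y = (numq x * denq y + numq y * denq x)%:Q / (denq x * denq y)%:Q.
  rewrite -{1}[x]divq_num_den -{1}[y]divq_num_den intrD !intrM.
  by field; rewrite !intr_eq0 !denq_neq0.
have s0 : numq x * denq y + numq y * denq x != 0.
  apply: contra xy0 => /eqP s0; by rewrite E s0 mul0r.
have a0 : numq x * denq y != 0 by rewrite mulf_neq0 ?denq_neq0 ?numq_eq0.
have b0 : numq y * denq x != 0 by rewrite mulf_neq0 ?denq_neq0 ?numq_eq0.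
have := lognD_min a0 b0 s0.
rewrite E ordq_frac ?mulf_neq0 ?denq_neq0 // /ordq.
rewrite !abszM !lognM ?absz_gt0 ?denq_neq0 ?numq_eq0 //.
move: (logn l _) (logn l _) (logn l _) (logn l _) (logn l _) => *; lia.
Qed.

Let l_gt0 : 0 < l%:R :> rat.
Proof. by rewrite ltr0n prime_gt0. Qed.

Lemma padic_norm0 : padic_norm l 0 = 0.
Proof. by rewrite /padic_norm eqxx. Qed.

Lemma padic_norm1 : padic_norm l 1 = 1.
Proof. by rewrite /padic_norm oner_eq0 /ordq /= logn1 subrr oppr0 expr0z. Qed.

Lemma padic_norm_eq0 x : (padic_norm l x == 0) = (x == 0).
Proof.
rewrite /padic_norm; case: ifP => [_|_]; first by rewrite eqxx.
by rewrite gt_eqF // exprz_gt0.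
Qed.

Lemma padic_norm_ge0 x : 0 <= padic_norm l x.
Proof. by rewrite /padic_norm; case: ifP => // _; rewrite exprz_ge0 ?ltW. Qed.

Lemma padic_normM x y : padic_norm l (x * y) = padic_norm l x * padic_norm l y.
Proof.
rewrite /padic_norm mulf_eq0.
case: (eqVneq x 0) => [_|x0] /=; first by rewrite mul0r.
case: (eqVneq y 0) => [_|y0] /=; first by rewrite mulr0.
by rewrite ordqM // opprD expfzDr // gt_eqF.
Qed.

Lemma padic_normN x : padic_norm l (- x) = padic_norm l x.
Proof. by rewrite /padic_norm oppr_eq0 /ordq numqN denqN abszN. Qed.

Lemma padic_normV x : padic_norm l x^-1 = (padic_norm l x)^-1.
Proof.
case: (eqVneq x 0) => [->|x0]; first by rewrite invr0 padic_norm0 ?invr0.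
have n0 : padic_norm l x != 0 by rewrite padic_norm_eq0.
by apply: (mulfI n0); rewrite -padic_normM !divff // padic_norm1.
Qed.

Lemma padic_normD x y :
  padic_norm l (x + y) <= Num.max (padic_norm l x) (padic_norm l y).
Proof.
case: (eqVneq x 0) => [->|x0]; first by rewrite add0r le_max lexx orbT.
case: (eqVneq y 0) => [->|y0]; first by rewrite addr0 le_max lexx.
case: (eqVneq (x + y) 0) => [->|xy0].
  by rewrite padic_norm0 le_max padic_norm_ge0.
rewrite /padic_norm (negbTE x0) (negbTE y0) (negbTE xy0).
have l1 : 1 < l%:R :> rat by rewrite ltr1n prime_gt1.
rewrite le_max !ler_eXz2l //.
by have := ordqD_min x0 y0 xy0; lia.
Qed.

Lemma padic_normB_lt x y e :
  padic_norm l x < e -> padic_norm l y < e -> padic_norm l (x - y) < e.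
Proof.
move=> xe ye; apply: le_lt_trans (padic_normD _ _) _.
by rewrite gt_max padic_normN xe.
Qed.

Lemma padic_normD_lt x y e :
  padic_norm l x < e -> padic_norm l y < e -> padic_norm l (x + y) < e.
Proof. by move=> xe ye; rewrite -[y]opprK padic_normB_lt ?padic_normN. Qed.

End PadicNorm.

Definition is_padic_cauchy (l : nat) (x : nat -> rat) : Prop :=
  forall e : rat, 0 < e -> exists N : nat, forall m n : nat,
    (N <= m)%N -> (N <= n)%N -> padic_norm l (x m - x n) < e.

Definition is_padic_null (l : nat) (x : nat -> rat) : Prop :=
  forall e : rat, 0 < e -> exists N : nat, forall n : nat,
    (N <= n)%N -> padic_norm l (x n) < e.

Section CauchyRing.
Variable l : prime_nat.
Let lP : prime (val l) := valP l.
Lemma padic_cauchy_bounded (x : nat -> rat) : is_padic_cauchy (val l) x ->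
  exists2 M : rat, 0 < M &
    exists N, forall n, (N <= n)%N -> padic_norm (val l) (x n) < M.
Proof.
move=> /(_ 1 ltr01)[N HN]; exists (padic_norm (val l) (x N) + 1).
  by rewrite ltr_wpDl ?padic_norm_ge0.
exists N => n Nn; rewrite -[x n](subrK (x N)); apply: padic_normD_lt => //.
  apply: lt_le_trans (HN _ _ Nn (leqnn _)) _.
  by rewrite lerDr padic_norm_ge0.
by rewrite ltrDl.
Qed.

Lemma padic_cauchyB (x y : nat -> rat) :
  is_padic_cauchy (val l) x -> is_padic_cauchy (val l) y ->
  is_padic_cauchy (val l) (x - y).
Proof.
move=> cx cy e e0; have [N HN] := cx e e0; have [N' HN'] := cy e e0.
exists (maxn N N') => m n; rewrite !geq_max => /andP[m1 m2] /andP[n1 n2].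
rewrite -[X in padic_norm _ X]/((x m - y m) - (x n - y n)).
have -> : x m - y m - (x n - y n) = (x m - x n) - (y m - y n) by ring.
by apply: padic_normB_lt; [|exact: HN|exact: HN'].
Qed.

Lemma padic_cauchyM (x y : nat -> rat) :
  is_padic_cauchy (val l) x -> is_padic_cauchy (val l) y ->
  is_padic_cauchy (val l) (x * y).
Proof.
move=> cx cy e e0.
have [M M0 [K HK]] := padic_cauchy_bounded cx.
have [M' M'0 [K' HK']] := padic_cauchy_bounded cy.
have [N HN] := cx _ (divr_gt0 e0 M'0); have [N' HN'] := cy _ (divr_gt0 e0 M0).
exists (maxn (maxn K K') (maxn N N')) => m n; rewrite !geq_max.
move=> /andP[/andP[mK mK'] /andP[mN mN']] /andP[/andP[nK nK'] /andP[nN nN']].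
rewrite -[X in padic_norm _ X]/(x m * y m - x n * y n).
have -> : x m * y m - x n * y n = x m * (y m - y n) + (x m - x n) * y n by ring.
apply: padic_normD_lt => //; rewrite padic_normM //.
  rewrite -[e](divfK (lt0r_neq0 M0)) mulrC.
  by apply: ltr_pM; rewrite ?padic_norm_ge0 ?HN' ?HK.
rewrite -[e](divfK (lt0r_neq0 M'0)).
by apply: ltr_pM; rewrite ?padic_norm_ge0 ?HN ?HK'.
Qed.

Definition padic_cauchy_pred : {pred nat -> rat} :=
  fun x => `[< is_padic_cauchy (val l) x >].

Lemma padic_cauchy_subring : subring_closed padic_cauchy_pred.
Proof.
split=> [|x y /asboolP cx /asboolP cy|x y /asboolP cx /asboolP cy].
- apply/asboolP => e e0; exists 0%N => m n _ _.
  by rewrite [X in padic_norm _ X](_ : _ = 0) ?padic_norm0 // /GRing.one /= subrr.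
- exact/asboolP/padic_cauchyB.
- exact/asboolP/padic_cauchyM.
Qed.

HB.instance Definition _ :=
  GRing.isSubringClosed.Build (nat -> rat) padic_cauchy_pred padic_cauchy_subring.

Record padic_cauchy :=
  PadicCauchy { padic_seq :> nat -> rat; _ : padic_seq \in padic_cauchy_pred }.

HB.instance Definition _ := [isSub for padic_seq].
HB.instance Definition _ := [Choice of padic_cauchy by <:].
HB.instance Definition _ := [SubChoice_isSubComNzRing of padic_cauchy by <:].

Lemma padic_cauchyP (x : padic_cauchy) : is_padic_cauchy (val l) x.
Proof. by apply/asboolP; exact: (valP x). Qed.

Definition padic_null : {pred padic_cauchy} :=
  fun x => `[< is_padic_null (val l) x >].

Lemma padic_null_ideal : idealr_closed padic_null.
Proof.
split.
- apply/asboolP => e e0; exists 0%N => n _.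
  by rewrite padic_norm0.
- apply/negP => /asboolP /(_ 1 ltr01)[N /(_ N (leqnn _))].
  by rewrite padic_norm1 // ltxx.
- move=> a x y /asboolP nx /asboolP ny; apply/asboolP => e e0.
  have [M M0 [K HK]] := padic_cauchy_bounded (padic_cauchyP a).
  have [N HN] := nx _ (divr_gt0 e0 M0); have [N' HN'] := ny _ e0.
  exists (maxn K (maxn N N')) => n; rewrite !geq_max => /and3P[nK nN nN'].
  apply: padic_normD_lt => //; last exact: HN'.
  rewrite padic_normM // -[e](divfK (lt0r_neq0 M0)) mulrC.
  by apply: ltr_pM; rewrite ?padic_norm_ge0 ?HN ?HK.
Qed.

HB.instance Definition _ := isIdealr.Build padic_cauchy padic_null padic_null_ideal.

(* The completion of [rat] for [padic_norm l], i.e. the field Q_l. *)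
Definition padic := {ideal_quot padic_null}.

HB.instance Definition _ := GRing.ComNzRing.on padic.
HB.instance Definition _ := NzRingQuotient.on padic.

Lemma padic_away (x : padic_cauchy) : x \notin padic_null ->
  exists2 e : rat, 0 < e &
    exists N, forall n, (N <= n)%N -> e <= padic_norm (val l) (x n).
Proof.
move=> /asboolPn/existsNP[e /not_implyP[e0 /forallNP nx]].
exists e => //; have [N HN] := padic_cauchyP x e0; exists N => m Nm.
have /existsNP[n /not_implyP[Nn /negP]] := nx N; rewrite -leNgt => en.
rewrite leNgt; apply/negP => me; move: en; apply/negP; rewrite -ltNge.
by rewrite -[x n](subrK (x m)) padic_normD_lt // HN.
Qed.

Definition padic_inv_seq (x : padic_cauchy) : padic_cauchy :=
  insubd (0 : padic_cauchy) (fun n => (x n)^-1).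

Lemma padic_inv_seqE (x : padic_cauchy) n : x \notin padic_null ->
  padic_inv_seq x n = (x n)^-1.
Proof.
move=> /padic_away[e e0 [N HN]].
rewrite /padic_inv_seq -[padic_seq _]/(val _) insubdK //; apply/asboolP => d d0.
have ee0 : 0 < e * e by rewrite mulr_gt0.
have [K HK] := padic_cauchyP x (mulr_gt0 d0 ee0).
exists (maxn N K) => i j; rewrite !geq_max => /andP[iN iK] /andP[jN jK].
have nz k : (N <= k)%N -> x k != 0.
  by move=> /HN ek; rewrite -(padic_norm_eq0 lP) gt_eqF // (lt_le_trans e0).
have -> : (x i)^-1 - (x j)^-1 = (x j - x i) / (x i * x j).
  by field; rewrite !nz.
rewrite padic_normM // padic_normV // padic_normM //.
rewrite ltr_pdivrMr; last by rewrite mulr_gt0 // (lt_le_trans e0) ?HN.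
apply: lt_le_trans (HK _ _ jK iK) _; rewrite ler_pM2l //.
by apply: ler_pM; rewrite ?HN // ltW.
Qed.

Definition padic_inv (a : padic) : padic :=
  if a == 0 then 0 else \pi_padic (padic_inv_seq (repr a)).

Lemma padic_mulVf (a : padic) : a != 0 -> padic_inv a * a = 1.
Proof.
rewrite /padic_inv => a0; rewrite (negbTE a0).
have xn : repr a \notin padic_null.
  apply: contra a0 => x0; rewrite -[a]reprK -[0](@pi_zeror _ _ _ _ _ padic).
  by rewrite -Quotient.idealrBE subr0.
rewrite -{2}[a]reprK -[1](@pi_oner _ _ _ _ _ _ _ padic) -pi_mulr.
apply/eqP; rewrite -Quotient.idealrBE; apply/asboolP => d d0.
have [e e0 [N HN]] := padic_away xn; exists N => n Nn.
rewrite [X in padic_norm _ X](_ : _ = padic_inv_seq (repr a) n * repr a n - 1) //.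
rewrite padic_inv_seqE // mulVf ?subrr ?padic_norm0 //.
by rewrite -(padic_norm_eq0 lP) gt_eqF // (lt_le_trans e0) ?HN.
Qed.

Lemma padic_invr0 : padic_inv 0 = 0.
Proof. by rewrite /padic_inv eqxx. Qed.

HB.instance Definition _ :=
  GRing.ComNzRing_isField.Build padic padic_mulVf padic_invr0.

End CauchyRing.

Inductive place := InfinitePlace | FinitePlace of prime_nat.

Definition completion (R : realType) (v : place) : fieldType :=
  match v with InfinitePlace => R | FinitePlace l => padic l end.

Definition in_S (p q : nat) (v : place) : bool :=
  match v with InfinitePlace => true | FinitePlace l => val l \in [:: 2%N; p; q] end.

Definition rat_unit := {x : rat | x != 0}.

Definition same_sqclass (x y : rat_unit) : bool :=
  `[< exists2 r : rat, r != 0 & val x = r ^+ 2 * val y >].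

Lemma same_sqclass_equiv : equiv_class_of same_sqclass.
Proof.
have sym x y : same_sqclass x y -> same_sqclass y x.
  move=> /asboolP[r r0 E]; apply/asboolP; exists r^-1; first by rewrite invr_eq0.
  by rewrite E; field.
split=> [x|x y|y x z].
- by apply/asboolP; exists 1; rewrite ?oner_eq0 // expr1n mul1r.
- by apply/idP/idP; exact: sym.
- move=> /asboolP[r r0 E] /asboolP[s s0 F]; apply/asboolP; exists (r * s).
    by rewrite mulf_neq0.
  by rewrite E F exprMn mulrA.
Qed.

Canonical same_sqclass_eq := EquivRelPack same_sqclass_equiv.
Canonical same_sqclass_enc := defaultEncModRel same_sqclass.

Definition sqclass := {eq_quot same_sqclass}.

Definition rat_unit1 : rat_unit := exist _ 1 (oner_neq0 _).

(* The class of [d]; only used for [d != 0] ([sqclass_of 0] is junk). *)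
Definition sqclass_of (d : rat) : sqclass := \pi_sqclass (insubd rat_unit1 d).

Definition QS2 (p q : nat) : set sqclass :=
  [set sqclass_of d | d in [set d : rat | d != 0 /\
     forall l : prime_nat, ~~ in_S p q (FinitePlace l) -> (2 %| ordq (val l) d)%Z]].

Definition has_quartic_point (K : fieldType) (a b : rat) : Prop :=
  exists u w z : K, (u, w, z) <> (0, 0, 0) /\
    w ^+ 2 = ratr a * u ^+ 4 + ratr b * z ^+ 4.

(* The quartics for [d] and [d * r ^ 2] are equivalent, by [w := r * w] and
   [z := r * z], so the choice of a representative is immaterial. *)
Definition selmer (R : realType) (p q : nat) (c : rat) : set sqclass :=
  [set sqclass_of d | d in [set d : rat | d != 0 /\ QS2 p q (sqclass_of d) /\
     forall v : place, in_S p q v ->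
       has_quartic_point (completion R v) d (c / d)]].

(* S^(phi)(E/Q) for E : y^2 = x^3 - pqx and its dual counterpart for
   y^2 = x^3 + 4pqx. *)
Definition selmer_phi (R : realType) (p q : nat) : set sqclass :=
  selmer R p q (4 * p * q)%:R.

Definition selmer_phihat (R : realType) (p q : nat) : set sqclass :=
  selmer R p q (- (16 * p * q)%:R).

(* The Legendre symbol (a / l), for [l] an odd prime. *)
Definition legendre (a l : nat) : int :=
  if (l %| a)%N then 0
  else if [exists x : 'I_l, (x ^ 2 == a %[mod l])%N] then 1 else -1.

(* Main.v *)
(* Every class of Q(S,2) has exactly one representative (-1)^s 2^i p^j q^k, and
   exchanging u and z pairs d with its complementary coefficient. Besides the
   two classes with a rational point and those insoluble over R or Q_2, this
   leaves six quartics: d = 2, p, 2p for phi and d = -1, p, q for the dual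
   isogeny. Clearing
   denominators turns a local point into a primitive integral solution modulo
   a power of the prime, and Newton's iteration for the square root gives the
   converse. At an odd prime this makes solubility of each quartic a condition
   on Legendre symbols, and at 2 a condition modulo 16. Quadratic reciprocity,
   proved with Gauss sums in a finite field of characteristic q, with its
   supplements for -1 and 2, expresses everything by (p/q) and the residues of
   p and q modulo 16, where the equivalence is a finite verification. *)
Require Import Defs.
From HB Require Import structures.
From mathcomp Require Import all_boot all_order all_algebra all_solvable all_field.
From mathcomp Require Import generic_quotient ring_quotient.
From mathcomp Require Import boolp classical_sets reals.
From mathcomp Require Import ring lra zify.

Set Implicit Arguments.
Unset Strict Implicit.
Unset Printing Implicit Defensive.

Import Order.TTheory GRing.Theory Num.Theory.
Local Open Scope ring_scope.

(** * Quadratic reciprocity *)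

(** The conditions become finite for a different reason at each place. At p and q, each of the six
    quartics has one unit coefficient and one of valuation exactly 1, so solubility depends only on
    whether the unit is a square modulo the prime. At 2, the fourth powers of odd integers fill the
    whole class of 1 modulo 16, so for odd a and b the values a u^4 + b with u odd run through the
    class of a + b modulo 16. Hence residues modulo 16 decide solubility, although a square root in
    Q_2 requires more bits than that of the value itself. The symbols (p/q) and (q/p) both occur in
    these conditions while the theorem mentions only the first, which is why reciprocity is
    required. In characteristic q the q-th power of a Gauss sum is the sum of the q-th powers, so no
    congruences between cyclotomic integers arise. *)

Lemma expf_card_pred (F : finFieldType) (x : F) : x != 0 -> x ^+ #|F|.-1 = 1.
Proof.
move=> x0; apply: (mulfI x0); rewrite mulr1 -exprS prednK ?expf_card //.
exact: ltnW (finNzRing_gt1 F).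
Qed.

(** The nonzero elements are n = |F| - 1 distinct n-th roots of unity, and n such roots in a field
    include a primitive one. *)
Lemma finField_prim_root (F : finFieldType) :
  exists z : F, #|F|.-1.-primitive_root z.
Proof.
have F1 : (0 < #|F|.-1)%N by rewrite -subn1 subn_gt0 finNzRing_gt1.
have H : has #|F|.-1.-primitive_root [seq x <- enum F | x != 0].
  apply: has_prim_root => //.
  - apply/allP => x; rewrite mem_filter unity_rootE => /andP[x0 _].
    by rewrite expf_card_pred.
  - by rewrite filter_uniq ?enum_uniq.
  - by rewrite -(cardC1 (0 : F)) cardE !enumT /enum_mem -enumT.
by have /hasP[z _ zP] := H; exists z.
Qed.

Definition is_square (F : finFieldType) (x : F) : bool := [exists y, y ^+ 2 == x].

(** The quadratic character of F, with values in a ring K independent of F: K is F itself in Euler's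
    criterion, a field of another characteristic for Gauss sums, and [int] for comparing signs. *)
Definition qchar (F : finFieldType) (K : nzRingType) (x : F) : K :=
  if x == 0 then 0 else (-1) ^+ ~~ is_square x.

(** For a primitive root z the power of z is -1, so z^i goes to (-1)^i, and the squares are the even
    powers. As |F| is odd, [#|F|./2] is (|F| - 1)/2. *)
Lemma euler_criterion (F : finFieldType) (x : F) : odd #|F| ->
  x ^+ #|F|./2 = qchar F x.
Proof.
move=> oddF; rewrite /qchar; case: eqVneq => [->|x0].
  rewrite expr0n; case: eqP => // E.
  by have := finNzRing_gt1 F; rewrite -[#|F|]odd_double_half oddF E.
have [z zP] := finField_prim_root F.
have E : #|F|.-1 = (#|F|./2 * 2)%N.
  by rewrite -[X in X.-1]odd_double_half oddF /= muln2.
have h0 : (0 < #|F|./2)%N by have := prim_order_gt0 zP; rewrite E muln_gt0 => /andP[].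
have zh : z ^+ #|F|./2 = -1.
  have : (z ^+ #|F|./2) ^+ 2 == 1 by rewrite -exprM -E (prim_expr_order zP).
  rewrite sqrf_eq1 => /orP[|/eqP //].
  by rewrite -(prim_order_dvd zP) E => /dvdn_leq; lia.
have /(prim_rootP zP)[i ->] := expf_card_pred x0.
rewrite -exprM mulnC exprM zh.
suff -> : ~~ is_square (z ^+ i) = odd i by rewrite signr_odd.
case: (boolP (odd i)) => oi.
  apply/negP; move=> /existsP[y /eqP yE].
  have y0 : y != 0.
    apply: contra_eq_neq yE => ->; rewrite expr0n /= eq_sym expf_neq0 //.
    by rewrite (prim_root_eq0 zP) -lt0n (prim_order_gt0 zP).
  have : (y ^+ 2) ^+ #|F|./2 = 1 by rewrite -exprM mulnC -E expf_card_pred.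
  rewrite yE -exprM mulnC exprM zh -signr_odd oi expr1 => /eqP.
  (* 2 divides the order of a primitive root of unity of F, so 2 is nonzero in F. *)
  rewrite -subr_eq0 -opprD oppr_eq0 -mulr2n; apply/negP.
  by rewrite (prim_root_dvd_eq0 zP) // E dvdn_mull.
apply/negbTE/negPn/existsP; exists (z ^+ i./2).
by rewrite -exprM muln2 -[X in _ == _ ^+ X]odd_double_half (negbTE oi).
Qed.

(** The relation between signs is settled in F, where Euler's criterion turns it into (xy)^h = x^h
    y^h and -1 differs from 1. It then holds in every K. *)
Lemma qcharM (F : finFieldType) (K : nzRingType) (x y : F) : odd #|F| ->
  qchar K (x * y) = qchar K x * qchar K y.
Proof.
move=> oddF; have := euler_criterion (x * y) oddF.
have F2 : -1 != 1 :> F.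
  have [z zP] := finField_prim_root F.
  rewrite -subr_eq0 -opprD oppr_eq0 -mulr2n (prim_root_dvd_eq0 zP) //.
  by rewrite dvdn2 -subn1 oddB ?oddF // ltnW ?finNzRing_gt1.
rewrite exprMn !euler_criterion // /qchar mulf_eq0.
have [|x0] := eqVneq x 0; first by rewrite !mul0r.
have [|y0] /= := eqVneq y 0; first by rewrite !mulr0.
case: (is_square x) (is_square y) (is_square (x * y)) => [] [] [] //=;
  rewrite ?expr0 ?expr1 ?mulrNN ?mulN1r ?mul1r ?mulr1 // => /eqP;
  by rewrite ?(negbTE F2) // eq_sym (negbTE F2).
Qed.

Lemma signr_neq1_inj (K : nzRingType) (b c : bool) : -1 != 1 :> K ->
  (-1) ^+ b = (-1) ^+ c :> K -> b = c.
Proof.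
by move=> K2; case: b c => [] [] //= /eqP; rewrite ?(negbTE K2) // eq_sym (negbTE K2).
Qed.

Lemma card_Fp_odd q : prime q -> odd q -> odd #|'F_q|.
Proof. by move=> qP; rewrite card_Fp. Qed.

Lemma pcharN1_neq1 q (K : nzRingType) : prime q -> odd q -> q \in [pchar K] -> -1 != 1 :> K.
Proof.
move=> qP oq qK; rewrite -subr_eq0 -opprD oppr_eq0 -mulr2n -(dvdn_pcharf qK).
by rewrite dvdn_prime2 //; apply: contraL oq => /eqP->.
Qed.

Lemma is_squareN1 q : prime q -> odd q -> is_square (-1 : 'F_q) = (q %% 4 == 1)%N.
Proof.
move=> qP oq; have := euler_criterion (-1 : 'F_q) (card_Fp_odd qP oq).
rewrite /qchar oppr_eq0 oner_eq0 card_Fp // -[LHS]signr_odd => E.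
have {E} : odd q./2 = ~~ is_square (-1 : 'F_q).
  by apply: signr_neq1_inj (pcharN1_neq1 qP oq (pchar_Fp qP)) E.
have : (q %% 4 == 1)%N = ~~ odd q./2 by lia.
by move=> -> ->; rewrite negbK.
Qed.

(** Euler's criterion in F_q is a congruence modulo q between integers, so it persists in every
    domain of characteristic q. *)
Lemma euler_pchar q (K : idomainType) a : prime q -> odd q -> q \in [pchar K] ->
  a%:R ^+ q./2 = qchar K (a%:R : 'F_q).
Proof.
move=> qP oq qK; have := euler_criterion (a%:R : 'F_q) (card_Fp_odd qP oq).
have qF := pchar_Fp qP.
rewrite /qchar card_Fp // -(dvdn_pcharf qF); case: ifP => [qa _|qa].
  have /eqP-> : a%:R == 0 :> K by rewrite -(dvdn_pcharf qK).
  by rewrite expr0n; case: (q) oq qP => [|[|[]]].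
have ak : (0 < a ^ q./2)%N by rewrite expn_gt0; case: (a) qa => [|n]; rewrite ?dvdn0.
rewrite -!natrX; case: (is_square _) => /=; rewrite ?expr0 ?expr1 => /eqP.
  rewrite -subr_eq0 -(natrB _ ak) -(dvdn_pcharf qF) (dvdn_pcharf qK) natrB //.
  by rewrite subr_eq0 => /eqP.
rewrite -addr_eq0 natr1 -(dvdn_pcharf qF) (dvdn_pcharf qK) -natr1.
by rewrite addr_eq0 => /eqP.
Qed.

(** By Euler's theorem n divides q^phi(n) - 1, the number of nonzero elements of the field with
    q^phi(n) elements. *)
Lemma prim_root_pchar q n : prime q -> coprime q n -> (0 < n)%N ->
  exists (K : finFieldType) (z : K), q \in [pchar K] /\ n.-primitive_root z.
Proof.
move=> qP qn n0; have k0 : (0 < totient n)%N by rewrite totient_gt0.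
have [K qK cK] := pPrimePowerField qP k0.
have [z zP] := finField_prim_root K.
exists K, (z ^+ (#|K|.-1 %/ n)); split=> //; apply: (dvdn_prim_root zP).
rewrite cK -subn1 -eqn_mod_dvd; last by rewrite expn_gt0 prime_gt0.
exact/eqP/Euler_exp_totient.
Qed.

Lemma qchar0 (F : finFieldType) (K : nzRingType) : qchar K (0 : F) = 0.
Proof. by rewrite /qchar eqxx. Qed.

Lemma qchar_sqr (F : finFieldType) (K : nzRingType) (x : F) : x != 0 -> qchar K x ^+ 2 = 1.
Proof. by rewrite /qchar => /negbTE->; rewrite sqrr_sign. Qed.

(** Multiplication by a primitive root, which is not a square, permutes F and changes the sign of
    the character; so the sum equals its opposite. *)
Lemma sum_qchar (F : finFieldType) (K : idomainType) : odd #|F| -> -1 != 1 :> K ->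
  \sum_(x : F) qchar K x = 0.
Proof.
move=> oddF K2; have [z zP] := finField_prim_root F.
have h0 : (0 < #|F|./2)%N by rewrite half_gt0 finNzRing_gt1.
have z0 : z != 0 by rewrite (prim_root_eq0 zP) -lt0n (prim_order_gt0 zP).
have zN : qchar K z = -1.
  have := euler_criterion z oddF; rewrite /qchar (negbTE z0).
  case: (is_square z) => //= /eqP; rewrite expr0 -(prim_order_dvd zP) => /dvdn_leq.
  by rewrite h0 => /(_ isT); lia.
set S := \sum_x _; have : S = - S.
  rewrite {1}/S (reindex_inj (mulfI z0)) /= -mulN1r big_distrr /=.
  by apply: eq_bigr => x _; rewrite qcharM // zN.
move/eqP; rewrite -addr_eq0 -mulr2n -mulr_natl mulf_eq0 => /orP[|/eqP//].
by move: K2; rewrite -subr_eq0 -opprD oppr_eq0 => /negbTE->.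
Qed.

(** * Gauss sums over F_p *)

Section GaussSum.

Variables (p : nat) (K : fieldType) (z : K).
Hypotheses (p_prime : prime p) (p_odd : odd p).
Hypotheses (zP : p.-primitive_root z) (K2 : -1 != 1 :> K).

(** The additive character of F_p attached to the root of unity z; x is read as its representative
    below p. *)
Let e (x : 'F_p) : K := z ^+ x.

Let eD x y : e (x + y) = e x * e y.
Proof.
rewrite /e -exprD -[RHS](prim_expr_mod zP); congr (_ ^+ _) => /=.
by rewrite [X in (_ %% X)%N](Fp_cast p_prime).
Qed.

Let eMn x n : e (n%:R * x) = e x ^+ n.
Proof.
rewrite mulr_natl; elim: n => [|n IHn]; first by rewrite mulr0n /e expr0.
by rewrite mulrS eD IHn exprS.
Qed.

(** Translating x by 1 multiplies the sum by [e c], which differs from 1 unless c = 0. *)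
Let sum_e (c : 'F_p) : \sum_x e (x * c) = if c == 0 then p%:R else 0.
Proof.
have [->|c0] := eqVneq c 0.
  under eq_bigr do rewrite mulr0 /e expr0.
  by rewrite sumr_const card_Fp.
have ec : e c != 1.
  apply: contra c0; rewrite /e -(prim_order_dvd zP) => /dvdnP[k ck].
  have := ltn_ord c; rewrite [X in (_ < X)%N](Fp_cast p_prime) ck.
  rewrite -[X in (_ < X)%N]mul1n ltn_mul2r ltnS leqn0 => /andP[_ /eqP k0].
  by apply/eqP/val_inj; rewrite /= ck k0.
set S := \sum_x _; have : S = S * e c.
  rewrite {1}/S (reindex_inj (addIr 1)) /= big_distrl /=.
  by apply: eq_bigr => x _; rewrite mulrDl mul1r eD.
move/eqP; rewrite -subr_eq0 -[X in X - _]mulr1 -mulrBr mulf_eq0 subr_eq0 eq_sym.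
by rewrite [1 == _]eq_sym (negbTE ec) orbF => /eqP.
Qed.

Let chi (x : 'F_p) := qchar K x.
Let G := \sum_x chi x * e x.

Let chiM x y : chi (x * y) = chi x * chi y.
Proof. by rewrite /chi qcharM // card_Fp_odd. Qed.

(** For a nonzero, substitute a x for x in G and use chi(a)^2 = 1; for a = 0 this is the vanishing
    of the character sum. *)
Let gauss_twist a : \sum_x chi x * e (a * x) = chi a * G.
Proof.
have [->|a0] := eqVneq a 0.
  under eq_bigr do rewrite mul0r /e expr0 mulr1.
  by rewrite sum_qchar ?card_Fp_odd // /chi qchar0 mul0r.
have c2 : chi a * chi a = 1 by rewrite -expr2 qchar_sqr.
rewrite -[LHS]mul1r -c2 -mulrA; congr (_ * _).
rewrite /G [RHS](reindex_inj (mulfI a0)) /= big_distrr /=.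
by apply: eq_bigr => x _; rewrite chiM mulrA.
Qed.

(* One factor of G^2 is expanded with [gauss_twist]; the sum over a of
   e (a * (x + 1)) then kills every x except -1. *)
Let gauss_sqr : G ^+ 2 = chi (-1) * p%:R.
Proof.
transitivity (\sum_a \sum_x chi x * e (a * (x + 1))).
  rewrite expr2 {1}/G big_distrl /=; apply: eq_bigr => a _.
  rewrite mulrAC -gauss_twist big_distrl /=; apply: eq_bigr => x _.
  by rewrite -mulrA -eD mulrDr mulr1.
rewrite exchange_big /= (bigD1 (-1)) //= [X in _ + X]big1 => [|x x1].
  by rewrite -big_distrr /= sum_e addNr eqxx addr0.
by rewrite -big_distrr /= sum_e addr_eq0 (negbTE x1) mulr0.
Qed.

(* Both sides are G^(q-1): on the left through [gauss_sqr], on the right by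
   applying the Frobenius automorphism to the sum G. *)
Lemma gauss_sum_char q : prime q -> odd q -> q \in [pchar K] -> q != p ->
  (qchar K (-1 : 'F_p) * p%:R) ^+ q./2 = qchar K (q%:R : 'F_p).
Proof.
move=> qP oq qK qp; rewrite -/(chi _) -gauss_sqr -/(chi _).
have pK : p%:R != 0 :> K by rewrite -(dvdn_pcharf qK) dvdn_prime2.
have G0 : G != 0.
  rewrite -sqrf_eq0 gauss_sqr mulf_neq0 // /chi /qchar oppr_eq0 oner_eq0.
  by rewrite signr_eq0.
have Gq : G * (G ^+ 2) ^+ q./2 = G ^+ q.
  by rewrite -exprM mul2n -exprS -{2}[q]odd_double_half oq.
apply: (mulfI G0); rewrite Gq.
rewrite -(pFrobenius_autE qK) rmorph_sum mulrC -gauss_twist; apply: eq_bigr => x _ /=.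
rewrite rmorphM /= !pFrobenius_autE -eMn; congr (_ * _).
rewrite /chi /qchar; case: eqP => _; first by rewrite expr0n gtn_eqF ?prime_gt0.
by rewrite exprAC -[(-1) ^+ q]signr_odd oq expr1.
Qed.

End GaussSum.

(** In K, Euler's criterion evaluates p^((q-1)/2) as (p/q), and the remaining factor
    (-1/p)^((q-1)/2) is -1 exactly when p and q are both 3 modulo 4. Signs can be compared in K
    because -1 differs from 1 there. *)
Lemma quadratic_reciprocity p q : prime p -> prime q -> odd p -> odd q -> p != q ->
  is_square (p%:R : 'F_q) =
  is_square (q%:R : 'F_p) (+) ((p %% 4 == 3) && (q %% 4 == 3))%N.
Proof.
move=> pP qP op oq pq.
have [K [z [qK zP]]] : exists (K : finFieldType) (z : K),
    q \in [pchar K] /\ p.-primitive_root z.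
  by apply: prim_root_pchar; rewrite ?prime_gt0 // prime_coprime // dvdn_prime2 // eq_sym.
have K2 := pcharN1_neq1 qP oq qK.
have := gauss_sum_char pP op zP K2 qP oq qK; rewrite eq_sym pq => /(_ isT).
rewrite exprMn (euler_pchar _ qP oq qK) /qchar oppr_eq0 oner_eq0.
rewrite -(dvdn_pcharf (pchar_Fp pP)) -(dvdn_pcharf (pchar_Fp qP)) !dvdn_prime2 //.
rewrite ?[q == p]eq_sym (negbTE pq) is_squareN1 //.
rewrite -exprM -[X in X * _]signr_odd -signr_addb => E.
have {E} := signr_neq1_inj K2 E; rewrite oddM.
have -> : odd q./2 = (q %% 4 == 3)%N by lia.
have -> : odd (p %% 4 != 1)%N = (p %% 4 == 3)%N by lia.
by case: (_ && _) (is_square _) (is_square _) => [] [] [].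
Qed.

(* For a primitive 8th root of unity z in characteristic q, z + 1/z is a square
   root of 2, and its q-th power depends only on q modulo 8. *)
Lemma is_square2 q : prime q -> odd q ->
  is_square (2 : 'F_q) = (q %% 8 == 1)%N || (q %% 8 == 7)%N.
Proof.
move=> qP oq.
have [K [z [qK zP]]] : exists (K : finFieldType) (z : K),
    q \in [pchar K] /\ 8.-primitive_root z.
  by apply: prim_root_pchar; rewrite // -[8%N]/(2 ^ 3)%N coprimeXr // coprimen2.
have K2 := pcharN1_neq1 qP oq qK.
have z8 := prim_expr_order zP.
have z4 : z ^+ 4 = -1.
  have : (z ^+ 4) ^+ 2 == 1 by rewrite -exprM z8.
  by rewrite sqrf_eq1 -(prim_order_dvd zP) /= => /eqP.
pose g := z + z ^+ 7.
have g2 : g ^+ 2 = 2.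
  rewrite /g; have -> : (z + z ^+ 7) ^+ 2 = z ^+ 2 * (1 + z ^+ 8 * z ^+ 4) + 2 * z ^+ 8 by ring.
  by rewrite z8 z4; ring.
have two0 : 2 != 0 :> K by move: K2; rewrite -subr_eq0 -opprD oppr_eq0.
have g0 : g != 0 by rewrite -sqrf_eq0 g2.
have : g ^+ q = g * qchar K (2%:R : 'F_q).
  rewrite -(euler_pchar _ qP oq qK) -g2 -exprM mul2n -exprS.
  by rewrite -{1}[q]odd_double_half oq.
rewrite -(pFrobenius_autE qK) rmorphD /= !pFrobenius_autE exprAC.
rewrite /qchar -(dvdn_pcharf (pchar_Fp qP)) dvdn_prime2 //.
rewrite gtn_eqF; last by case: (q) qP oq => [|[|[]]].
rewrite -[z ^+ q](prim_expr_mod zP) => E.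
have sqE (c : bool) : z ^+ (q %% 8) + (z ^+ (q %% 8)) ^+ 7 = g * (-1) ^+ c ->
    is_square (2 : 'F_q) = ~~ c.
  by rewrite E => /(mulfI g0)/(signr_neq1_inj K2) <-; rewrite negbK.
have [r|[r|[r|r]]] : (q %% 8 = 1 \/ q %% 8 = 3 \/ q %% 8 = 5 \/ q %% 8 = 7)%N by lia.
- by rewrite (sqE false) r // mulr1.
- rewrite (sqE true) r //.
  have -> : z ^+ 3 + z ^+ 3 ^+ 7 = z ^+ 4 * (z * z ^+ 8 ^+ 2) + z ^+ 3 by ring.
  have -> : z ^+ 3 = z ^+ 4 * z ^+ 7 by rewrite -exprD (exprD z 8 3) z8 mul1r.
  by rewrite z4 z8 /g; ring.
- rewrite (sqE true) r //.
  have -> : z ^+ 5 + z ^+ 5 ^+ 7 = z ^+ 4 * (z + z ^+ 7 * z ^+ 8 ^+ 3) by ring.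
  by rewrite z4 z8 /g; ring.
- rewrite (sqE false) r //.
  have -> : z ^+ 7 + z ^+ 7 ^+ 7 = z ^+ 7 + z * z ^+ 8 ^+ 6 by ring.
  by rewrite z8 /g; ring.
Qed.

(** * Square roots and primitive points in Q_l *)

Section PadicPoints.
Variable l : prime_nat.
Let lP : prime (val l) := valP l.
Local Notation "| x |" := (padic_norm (val l) x) (at level 30, x at level 99).

Lemma padic_cst_subproof (x : rat) : (fun=> x) \in @padic_cauchy_pred l.
Proof.
by apply/asboolP => e e0; exists 0%N => m n _ _; rewrite subrr padic_norm0.
Qed.

Definition padic_cst x : padic_cauchy l := PadicCauchy (padic_cst_subproof x).

Definition padic_of_rat (x : rat) : padic l := \pi_(padic l)%qT (padic_cst x).

Lemma padic_eqP (x y : padic_cauchy l) :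
  (\pi_(padic l)%qT x = \pi_(padic l)%qT y) <-> is_padic_null (val l) (fun n => x n - y n).
Proof.
split=> [/eqP|H]; first by rewrite -Quotient.idealrBE => /asboolP.
by apply/eqP; rewrite -Quotient.idealrBE; apply/asboolP.
Qed.

Lemma padic_of_rat_is_zmod_morphism : zmod_morphism padic_of_rat.
Proof.
move=> x y; rewrite /padic_of_rat -rmorphB.
by apply/padic_eqP => e e0; exists 0%N => n _; rewrite subrr padic_norm0.
Qed.

Lemma padic_of_rat_is_monoid_morphism : monoid_morphism padic_of_rat.
Proof.
split.
  rewrite -(rmorph1 \pi_(padic l)%qT); apply/padic_eqP => e e0; exists 0%N => n _.
  by rewrite subrr padic_norm0.
move=> x y; rewrite /padic_of_rat -rmorphM.
by apply/padic_eqP => e e0; exists 0%N => n _; rewrite subrr padic_norm0.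
Qed.

HB.instance Definition _ := GRing.isZmodMorphism.Build rat (padic l) padic_of_rat
  padic_of_rat_is_zmod_morphism.
HB.instance Definition _ := GRing.isMonoidMorphism.Build rat (padic l) padic_of_rat
  padic_of_rat_is_monoid_morphism.

(** Every ring morphism from Q to a field agrees with [ratr], so the coefficients of the quartics
    are classes of constant sequences. *)
Lemma ratr_padic (x : rat) : ratr x = padic_of_rat x.
Proof. by rewrite -(fmorph_eq_rat padic_of_rat). Qed.

Lemma padic_seqM (x y : padic_cauchy l) n : (x * y) n = x n * y n.
Proof. by []. Qed.

Lemma padic_seqD (x y : padic_cauchy l) n : (x + y) n = x n + y n.
Proof. by []. Qed.

Lemma padic_seqX (x : padic_cauchy l) k n : (x ^+ k) n = x n ^+ k.
Proof. by elim: k => // k IHk; rewrite !exprS padic_seqM IHk. Qed.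

(** Makes an equation in the quotient ring a limit statement about rational sequences, which can
    then be cut off at a finite index. *)
Lemma padic_quartic_null (a b : rat) (u w z : padic_cauchy l) :
  (\pi_(padic l)%qT w ^+ 2 =
     ratr a * \pi_(padic l)%qT u ^+ 4 + ratr b * \pi_(padic l)%qT z ^+ 4) <->
  is_padic_null (val l) (fun n => w n ^+ 2 - (a * u n ^+ 4 + b * z n ^+ 4)).
Proof.
have E n : w n ^+ 2 - (a * u n ^+ 4 + b * z n ^+ 4) =
    (w ^+ 2) n - (padic_cst a * u ^+ 4 + padic_cst b * z ^+ 4) n.
  rewrite padic_seqD padic_seqX [(padic_cst a * _) n]padic_seqM.
  by rewrite [(padic_cst b * _) n]padic_seqM !padic_seqX.
rewrite !ratr_padic /padic_of_rat -!rmorphXn -!rmorphM -rmorphD (funext E).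
exact: padic_eqP.
Qed.

Lemma padic_norm_gt0 (x : rat) : x != 0 -> 0 < |x|.
Proof. by move=> x0; rewrite lt0r padic_norm_eq0 // x0 padic_norm_ge0. Qed.

Lemma padic_norm_int (m : int) : m != 0 ->
  |m%:~R| = ((val l)%:R ^+ logn (val l) `|m|%N)^-1.
Proof.
move=> m0; rewrite /padic_norm intr_eq0 (negbTE m0) /ordq.
by rewrite numq_int denq_int /= logn1 subr0 exprnN.
Qed.

Let l_gt0 : 0 < (val l)%:R :> rat.
Proof. by rewrite ltr0n prime_gt0. Qed.

Let l_gt1 : 1 < (val l)%:R :> rat.
Proof. by rewrite ltr1n prime_gt1. Qed.

Lemma padic_norm_int_le (m : int) k :
  (|m%:~R| <= ((val l)%:R ^+ k)^-1) = ((val l ^ k)%:Z %| m)%Z.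
Proof.
have [->|m0] := eqVneq m 0.
  by rewrite dvdz0 padic_norm0 invr_ge0 exprn_ge0 // ltW.
rewrite padic_norm_int // lef_pV2 ?posrE ?exprn_gt0 // ler_eXn2l //.
by rewrite dvdzE /= pfactor_dvdn ?absz_gt0.
Qed.

Lemma padic_norm_int_le1 (m : int) : |m%:~R| <= 1.
Proof. by have := padic_norm_int_le m 0; rewrite expr0 invr1 expn0 dvd1z. Qed.

Lemma padic_norm_int_lt1 (m : int) : (|m%:~R| < 1) = ((val l)%:Z %| m)%Z.
Proof.
apply/idP/idP => [|H].
  have [->|m0] := eqVneq m 0; first by rewrite dvdz0.
  rewrite padic_norm_int // invf_lt1 ?exprn_gt0 //.
  rewrite exprn_egt1 ?ltW // dvdzE /= => H.
  by rewrite -[val l]expn1 pfactor_dvdn ?absz_gt0 // lt0n; case: (logn _ _) H; rewrite ?ltxx.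
apply: (@le_lt_trans _ _ ((val l)%:R ^+ 1)^-1).
  by rewrite padic_norm_int_le expn1.
by rewrite expr1 invf_lt1.
Qed.

Lemma padic_norm_int1 (m : int) : ~~ ((val l)%:Z %| m)%Z -> |m%:~R| = 1.
Proof.
rewrite -padic_norm_int_lt1 -leNgt => H.
by apply/eqP; rewrite eq_le H padic_norm_int_le1.
Qed.

Lemma padic_norm_denq (x : rat) : |x| <= 1 -> |(denq x)%:~R| = 1.
Proof.
move=> x1; apply: padic_norm_int1; apply/negP => ld.
have ln : ~~ ((val l)%:Z %| numq x)%Z.
  apply/negP => ln; have := coprime_num_den x; rewrite /coprime => /eqP g1.
  have : (val l %| gcdn `|numq x| `|denq x|)%N by move: ld ln; rewrite dvdn_gcd !dvdzE /= => -> ->.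
  by rewrite g1 Euclid_dvd1.
move: x1; rewrite -{1}[x]divq_num_den padic_normM // padic_normV //.
rewrite padic_norm_int1 // mul1r => x1.
have d0 : 0 < |(denq x)%:~R|.
  by rewrite padic_norm_gt0 // intr_eq0 denq_neq0.
by move: ld; rewrite -padic_norm_int_lt1 -invf_gt1 // ltNge x1.
Qed.

Lemma padic_normX (x : rat) k : |x ^+ k| = |x| ^+ k.
Proof. by elim: k => [|k IHk]; rewrite ?padic_norm1 // !exprS padic_normM // IHk. Qed.

Lemma padic_normD_le (x y e : rat) : |x| <= e -> |y| <= e -> |x + y| <= e.
Proof. by move=> xe ye; apply: le_trans (padic_normD lP _ _) _; rewrite ge_max xe. Qed.

Lemma padic_normD_unit (x d : rat) : |x| = 1 -> |d| < 1 -> |x + d| = 1.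
Proof.
move=> x1 d1; apply/eqP; rewrite eq_le padic_normD_le ?x1 ?(ltW d1) //=.
rewrite leNgt; apply/negP => xd; have := padic_normB_lt lP xd d1.
by rewrite addrK x1 ltxx.
Qed.

(** The nonzero values of the norm are integral powers of l, so a value below 1 is at most 1/l. The
    bound 1/2 gives one convergence rate for all primes. *)
Lemma padic_norm_lt1 (x : rat) : |x| < 1 -> |x| <= 2^-1.
Proof.
have [->|x0] := eqVneq x 0; first by rewrite padic_norm0.
rewrite /padic_norm (negbTE x0).
case: (leP (ordq (val l) x) 0) => [o0|o0].
  rewrite ltNge -[1 in X in X -> _](expr0z (val l)%:R) ler_eXz2l //.
  by rewrite oppr_ge0 o0.
move=> _; apply: (@le_trans _ _ ((val l)%:R ^ (-1))); first by rewrite ler_eXz2l //; lia.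
by rewrite exprN1 lef_pV2 ?posrE // (ler_nat _ 2) prime_gt1.
Qed.

(* Newton's iteration turns the residue x^2 - a into its square divided by
   4 x^2, so |x^2 - a| < |4| suffices for convergence, also when l = 2. *)
Section Newton.
Variables a x0 : rat.
Hypotheses (x01 : |x0| = 1) (x0a : |x0 ^+ 2 - a| < |4|).

Let newton n := iter n (fun x => (x + a / x) / 2) x0.

Let n40 : 0 < |4|.
Proof. by apply: le_lt_trans x0a; apply: padic_norm_ge0. Qed.

Let n2_le1 : |2| <= 1.
Proof. exact: (padic_norm_int_le1 2). Qed.

(** The factor |4| cancels the denominator of the next step: squaring the bound and dividing by |4|
    leaves |4| 2^-(2n+2), at most the rate claimed for n + 1. The start uses that the norm is
    discrete: a residue below |4| is at most |4|/2. *)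
Let newton_bound n : |newton n| = 1 /\ |newton n ^+ 2 - a| <= |4| * 2^-1 ^+ n.+1.
Proof.
elim: n => [|n]; first split=> //.
  rewrite expr1 mulrC -ler_pdivrMr //; rewrite -padic_normV // -padic_normM //.
  by apply: padic_norm_lt1; rewrite padic_normM // padic_normV // ltr_pdivrMr // mul1r.
rewrite /newton iterS -/(newton n); set x := newton n => -[x1 xa].
have xn0 : x != 0 by rewrite -(padic_norm_eq0 lP) x1 oner_eq0.
have four : |4| = |2| * |2| by rewrite -padic_normM.
have n20 : 0 < |2| by exact: padic_norm_gt0.
split.
  have -> : (x + a / x) / 2 = x + (a - x ^+ 2) / (2 * x) by field.
  apply: padic_normD_unit => //; rewrite padic_normM // padic_normV // padic_normM //.
  rewrite x1 mulr1 ltr_pdivrMr // mul1r -opprB padic_normN.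
  apply: le_lt_trans xa _; rewrite four -mulrA gtr_pMr //.
  apply: (@le_lt_trans _ _ (2^-1 ^+ n.+1)); first by rewrite ler_piMl ?exprn_ge0.
  by rewrite exprn_ilt1.
have -> : ((x + a / x) / 2) ^+ 2 - a = (x ^+ 2 - a) ^+ 2 / (4 * x ^+ 2) by field.
rewrite padic_normM // padic_normV // [|4 * _|]padic_normM // !padic_normX x1 expr1n mulr1.
rewrite ler_pdivrMr //; apply: (@le_trans _ _ ((|4| * 2^-1 ^+ n.+1) ^+ 2)).
  by rewrite lerXn2r // ?nnegrE ?padic_norm_ge0 // mulr_ge0 ?exprn_ge0 ?ltW.
rewrite exprMn -exprM expr2 [leRHS]mulrAC ler_pM2l ?mulr_gt0 // ler_wiXn2l //.
by rewrite muln2 -addnn addSn ltnS leq_addl.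
Qed.

Let newton_step n : |newton n.+1 - newton n| <= 2^-1 ^+ n.+1.
Proof.
have [x1 xa] := newton_bound n; rewrite /newton iterS -/(newton n).
set x := newton n in x1 xa *.
have xn0 : x != 0 by rewrite -(padic_norm_eq0 lP) x1 oner_eq0.
have n20 : 0 < |2| by exact: padic_norm_gt0.
have -> : (x + a / x) / 2 - x = - (x ^+ 2 - a) / (2 * x) by field.
rewrite padic_normM // padic_normN padic_normV // padic_normM // x1 mulr1.
rewrite ler_pdivrMr //; apply: le_trans xa _.
rewrite [|4|](padic_normM lP 2 2) mulrC ler_wpM2l ?exprn_ge0 //.
by rewrite ler_piMr // ltW.
Qed.

Let newton_close N k : |newton (N + k) - newton N| <= 2^-1 ^+ N.+1.
Proof.
elim: k => [|k IHk]; first by rewrite addn0 subrr padic_norm0 exprn_ge0.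
rewrite addnS -[X in X - _](subrK (newton (N + k))) -addrA.
apply: padic_normD_le => //; apply: le_trans (newton_step _) _.
by rewrite ler_wiXn2l // ltnS leq_addr.
Qed.

Lemma small_pow (e : rat) : 0 < e -> exists N, forall n, (N <= n)%N -> 2^-1 ^+ n < e.
Proof.
move=> e0; exists (Num.bound e^-1) => n /upper_nthrootP.
by rewrite exprVn invf_plt ?posrE ?exprn_gt0.
Qed.

Lemma padic_sqrt : exists y : padic l, y ^+ 2 = ratr a.
Proof.
have newton_cauchy : newton \in @padic_cauchy_pred l.
  apply/asboolP => e /small_pow[N HN]; exists N => m n Nm Nn.
  rewrite -(subnKC Nm) -(subnKC Nn).
  rewrite -[X in _ - X](subrK (newton N)) opprD [- _ - _]addrC addrA.
  by apply: padic_normB_lt => //; apply: le_lt_trans (newton_close _ _) (HN _ _); lia.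
exists (\pi_(padic l)%qT (PadicCauchy newton_cauchy)).
rewrite ratr_padic /padic_of_rat -rmorphXn; apply/padic_eqP => e e0.
have [N HN] := small_pow (divr_gt0 e0 n40).
exists N => n Nn; rewrite padic_seqX /=.
have [_ H] := newton_bound n; apply: le_lt_trans H _.
by rewrite mulrC -ltr_pdivlMr //; apply: HN; lia.
Qed.

End Newton.

(* The quartic is weighted homogeneous: a rational approximation is normalised by
   dividing u and z by the one of larger norm. *)
Lemma padic_quartic_approx (a b eps : rat) : 0 < eps ->
  has_quartic_point (padic l) a b ->
  exists u w z : rat, [/\ |u| <= 1, |z| <= 1, |u| = 1 \/ |z| = 1 &
    |w ^+ 2 - (a * u ^+ 4 + b * z ^+ 4)| <= eps].
Proof.
move=> eps0 [u0 [w0 [z0 [nz]]]]; rewrite -[u0]reprK -[w0]reprK -[z0]reprK.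
set u := repr u0; set w := repr w0; set z := repr z0 => /padic_quartic_null null.
(* If u and z were both null, the equation would make w null too, against the nontriviality of the
   point. *)
have [e e0 [N HN]] : exists2 e : rat, 0 < e & exists N, forall n, (N <= n)%N ->
    e <= |u n| \/ e <= |z n|.
  have nul0 (v : padic l) : repr v \in @padic_null l -> v = 0.
    move=> H; rewrite -[v]reprK -(rmorph0 \pi_(padic l)%qT).
    by apply/eqP; rewrite -Quotient.idealrBE subr0.
  have [un|un] := boolP (u \in @padic_null l); last first.
    by have [e e0 [N HN]] := padic_away un; exists e => //; exists N => n /HN; left.
  have [zn|zn] := boolP (z \in @padic_null l); last first.
    by have [e e0 [N HN]] := padic_away zn; exists e => //; exists N => n /HN; right.
  exfalso; apply: nz; move: null.
  have [wn|wn] := boolP (w \in @padic_null l).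
    by rewrite (nul0 _ un) (nul0 _ zn) (nul0 _ wn).
  move=> /padic_quartic_null; rewrite !reprK (nul0 _ un) (nul0 _ zn).
  rewrite !expr0n !mulr0 addr0 => /eqP; rewrite sqrf_eq0 => /eqP w00.
  by rewrite w00.
(* Dividing by r^4 with |r| at least e costs at most a factor e^-4, hence the accuracy eps e^4. *)
have [K HK] := null _ (mulr_gt0 eps0 (exprn_gt0 4 e0)).
pose n := maxn N K; have {}HK := HK n (leq_maxr _ _); have {}HN := HN n (leq_maxl _ _).
have [r [er [ru rz] r1]] : exists r, [/\ e <= |r|, |u n| <= |r| /\ |z n| <= |r| &
    r = u n \/ r = z n].
  case: (leP (|u n|) (|z n|)) => [uz|/ltW zu].
    by exists (z n); split; auto; case: HN => // /le_trans; apply.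
  by exists (u n); split; auto; case: HN => // /le_trans; apply.
have rp : 0 < |r| by apply: lt_le_trans er.
have r0 : r != 0 by rewrite -(padic_norm_eq0 lP) gt_eqF.
exists (u n / r), (w n / r ^+ 2), (z n / r); split.
- by rewrite padic_normM // padic_normV // ler_pdivrMr // mul1r.
- by rewrite padic_normM // padic_normV // ler_pdivrMr // mul1r.
- by case: r1 => <-; [left|right]; rewrite divff // padic_norm1.
have -> : (w n / r ^+ 2) ^+ 2 - (a * (u n / r) ^+ 4 + b * (z n / r) ^+ 4) =
    (w n ^+ 2 - (a * u n ^+ 4 + b * z n ^+ 4)) / r ^+ 4 by field.
rewrite padic_normM // padic_normV // padic_normX ler_pdivrMr ?exprn_gt0 //.
apply: le_trans (ltW HK) _; rewrite ler_pM2l // lerXn2r // nnegrE ltW //.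
Qed.

Lemma padic_integral_mul (x : rat) : |x| <= 1 ->
  exists2 D : int, |D%:~R| = 1 & exists m : int, x * D%:~R = m%:~R.
Proof.
move=> /padic_norm_denq H; exists (denq x) => //; exists (numq x).
by rewrite -{1}[x]divq_num_den divfK // intr_eq0 denq_neq0.
Qed.

Lemma quartic_primitive (a b : int) k :
  has_quartic_point (padic l) a%:~R b%:~R ->
  exists u w z : int, ~~ (((val l)%:Z %| u)%Z && ((val l)%:Z %| z)%Z) /\
    ((val l ^ k)%:Z %| w ^+ 2 - (a * u ^+ 4 + b * z ^+ 4))%Z.
Proof.
have eps0 : 0 < ((val l)%:R ^+ k)^-1 :> rat by rewrite invr_gt0 exprn_gt0.
have eps1 : ((val l)%:R ^+ k)^-1 <= 1 :> rat.
  by rewrite invf_le1 ?exprn_gt0 // exprn_ege1 // ltW.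
move=> /(padic_quartic_approx eps0)[u [w [z [u1 z1 uz err]]]].
have w1 : |w| <= 1.
  rewrite -(@expr_le1 _ 2) ?padic_norm_ge0 // -padic_normX.
  rewrite -[w ^+ 2](subrK (a%:~R * u ^+ 4 + b%:~R * z ^+ 4)).
  apply: padic_normD_le; first exact: le_trans eps1.
  by apply: padic_normD_le; rewrite padic_normM // padic_normX mulr_ile1
    ?exprn_ge0 ?padic_norm_ge0 ?padic_norm_int_le1 // exprn_ile1 ?padic_norm_ge0.
have [D D1 [U UE]] := padic_integral_mul u1.
have [E E1 [Z ZE]] := padic_integral_mul z1.
have [F F1 [W WE]] := padic_integral_mul w1.
(* C is an l-adic unit that clears all three denominators. By weighted homogeneity u and z are
   multiplied by C, and w by C^2. *)
pose C : rat := (D * E * F)%:~R.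
have C1 : |C| = 1 by rewrite /C !intrM !padic_normM // D1 E1 F1 !mulr1.
have [u' uE] : exists u' : int, u'%:~R = u * C.
  by exists (U * E * F); rewrite !intrM -UE; ring.
have [z' zE] : exists z' : int, z'%:~R = z * C.
  by exists (Z * D * F); rewrite /C !intrM -ZE; ring.
have [w' wE] : exists w' : int, w'%:~R = w * C ^+ 2.
  by exists (W * D * E * (D * E * F)); rewrite /C !intrM -WE; ring.
exists u', w', z'; split.
  rewrite -!padic_norm_int_lt1 uE zE !padic_normM // C1 !mulr1.
  by case: uz => ->; rewrite ltxx ?andbF.
rewrite -padic_norm_int_le !(rmorphB, rmorphD, rmorphXn, rmorphM) /= uE zE wE.
rewrite [X in |X|](_ : _ = (w ^+ 2 - (a%:~R * u ^+ 4 + b%:~R * z ^+ 4)) * C ^+ 4); last by ring.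
by rewrite padic_normM // padic_normX C1 expr1n mulr1.
Qed.

End PadicPoints.

(** * Local solubility of quartics *)

(** Fourth powers are known modulo 16, so a quartic with coefficients 2a and 2b is known modulo 32;
    squares are needed to the same precision. *)
Lemma sqrz_mod32 (w : int) :
  (w ^+ 2 %% 32)%Z \in [:: 0; 1; 4; 9; 16; 17; 25].
Proof.
have [j [r [-> ]]] : exists j r : int, w = 16 * j + r /\ 0 <= r < 16.
  by exists (w %/ 16)%Z, (w %% 16)%Z; split; lia.
case: r => // r /andP[_ r16].
have -> : (16 * j + r%:Z) ^+ 2 = (8 * j ^+ 2 + j * r%:Z) * 32 + r%:Z ^+ 2 by ring.
rewrite modzMDl; by do 16![case: r r16 => [_ //|r] r16]; lia.
Qed.

Lemma pow4_mod16 (u : int) : (u ^+ 4 %% 16)%Z = (u %% 2)%Z.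
Proof.
have [j [r [-> ]]] : exists j r : int, u = 4 * j + r /\ 0 <= r < 4.
  by exists (u %/ 4)%Z, (u %% 4)%Z; split; lia.
case: r => // r /andP[_ r4].
have -> : ((4 * j + r%:Z) %% 2)%Z = (r%:Z %% 2)%Z by lia.
have -> : (4 * j + r%:Z) ^+ 4 = (16 * j ^+ 4 + 16 * j ^+ 3 * r%:Z +
  6 * j ^+ 2 * r%:Z ^+ 2 + j * r%:Z ^+ 3) * 16 + r%:Z ^+ 4 by ring.
rewrite modzMDl; by do 4![case: r r4 => [_ //|r] r4]; lia.
Qed.

Lemma mul_pow4_mod16 (a u : int) : (a * u ^+ 4 = a * (u %% 2)%Z %[mod 16])%Z.
Proof. by rewrite -modzMmr pow4_mod16. Qed.

(** The witnesses tabulate a fourth root of 1 + 16 t modulo 256 for each t modulo 16. *)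
Lemma pow4_surj (t : int) : exists2 u : int, ~~ (2 %| u)%Z & (u ^+ 4 = 1 + 16 * t %[mod 256])%Z.
Proof.
have [j [r [-> ]]] : exists j r : int, t = 16 * j + r /\ 0 <= r < 16.
  by exists (t %/ 16)%Z, (t %% 16)%Z; split; lia.
have -> : 1 + 16 * (16 * j + r) = j * 256 + (1 + 16 * r) by ring.
rewrite modzMDl; case: r => // r /andP[_ r16].
case: r r16 => [_|r r16]; first by exists 1; lia.
case: r r16 => [_|r r16]; first by exists 19; lia.
case: r r16 => [_|r r16]; first by exists 23; lia.
case: r r16 => [_|r r16]; first by exists 11; lia.
case: r r16 => [_|r r16]; first by exists 17; lia.
case: r r16 => [_|r r16]; first by exists 3; lia.
case: r r16 => [_|r r16]; first by exists 7; lia.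
case: r r16 => [_|r r16]; first by exists 5; lia.
case: r r16 => [_|r r16]; first by exists 31; lia.
case: r r16 => [_|r r16]; first by exists 13; lia.
case: r r16 => [_|r r16]; first by exists 9; lia.
case: r r16 => [_|r r16]; first by exists 21; lia.
case: r r16 => [_|r r16]; first by exists 15; lia.
case: r r16 => [_|r r16]; first by exists 29; lia.
case: r r16 => [_|r r16]; first by exists 25; lia.
case: r r16 => [_|r r16]; first by exists 27; lia.
lia.
Qed.

Lemma has_quartic_pointC (K : fieldType) (a b : rat) :
  has_quartic_point K a b -> has_quartic_point K b a.
Proof.
move=> [u [w [z [nz E]]]]; exists z, w, u; split; last by rewrite addrC.
by move=> [z0 w0 u0]; apply: nz; rewrite z0 w0 u0.
Qed.

Section LocalPoints.
Variable l : prime_nat.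
Let lP : prime (val l) := valP l.

Lemma padic_sqrt_odd (a x : int) : odd (val l) -> ~~ ((val l)%:Z %| x)%Z ->
  ((val l)%:Z %| x ^+ 2 - a)%Z -> exists y : padic l, y ^+ 2 = ratr a%:~R.
Proof.
move=> lodd lx lxa; apply: (@padic_sqrt l _ x%:~R); first exact: padic_norm_int1.
have -> : padic_norm (val l) 4 = 1.
  apply: (@padic_norm_int1 l 4); rewrite dvdzE -[`|4|%N]/(2 ^ 2)%N Euclid_dvdX // dvdn_prime2 //.
  by rewrite andbT; apply: contraL lodd => /eqP /= ->.
by rewrite -rmorphXn -rmorphB /= padic_norm_int_lt1.
Qed.

Lemma padic_sqrt_2 (a : int) : val l = 2%N -> (a = 1 %[mod 8])%Z ->
  exists y : padic l, y ^+ 2 = ratr a%:~R.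
Proof.
move=> l2 a1; apply: (@padic_sqrt l _ 1); first by rewrite padic_norm1.
apply: (@le_lt_trans _ _ ((val l)%:R ^+ 3)^-1).
  rewrite expr1n -(rmorph1 (intmul 1)) -rmorphB /= padic_norm_int_le l2.
  lia.
by rewrite (@padic_norm_int l 4) // l2.
Qed.

Lemma quartic_point_sqr (a b u z s m : int) (y : padic l) : (u != 0) || (z != 0) ->
  a * u ^+ 4 + b * z ^+ 4 = s ^+ 2 * m -> y ^+ 2 = ratr m%:~R ->
  has_quartic_point (padic l) a%:~R b%:~R.
Proof.
move=> uz E yE; exists (padic_of_rat l u%:~R), (padic_of_rat l s%:~R * y),
  (padic_of_rat l z%:~R); split.
  move=> [/eqP + _ /eqP]; rewrite !fmorph_eq0 !intr_eq0.
  by case/orP: uz => /negbTE->.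
rewrite exprMn yE !ratr_padic -!rmorphXn -!rmorphM -rmorphD /=.
by rewrite -intrD E.
Qed.

Lemma dvdz_primeM (m n : int) :
  ((val l)%:Z %| m * n)%Z = ((val l)%:Z %| m)%Z || ((val l)%:Z %| n)%Z.
Proof. by rewrite !dvdzE abszM /= Euclid_dvdM. Qed.

Lemma dvdz_primeX (m : int) k :
  ((val l)%:Z %| m ^+ k.+1)%Z = ((val l)%:Z %| m)%Z.
Proof. by rewrite !dvdzE abszX /= Euclid_dvdX // andbT. Qed.

Lemma Fp_intr_eq0 (m : int) : (m%:~R == 0 :> 'F_(val l)) = ((val l)%:Z %| m)%Z.
Proof. by rewrite (dvdz_pcharf (pchar_Fp lP)). Qed.

Lemma quartic_point_square (a b : int) : odd (val l) -> ~~ ((val l)%:Z %| a)%Z ->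
  is_square (a%:~R : 'F_(val l)) -> has_quartic_point (padic l) a%:~R b%:~R.
Proof.
move=> lodd la /existsP[x /eqP xE].
have lx : ((val l)%:Z %| x%:Z ^+ 2 - a)%Z.
  by rewrite -Fp_intr_eq0 rmorphB rmorphXn /= -pmulrn natr_Zp xE subrr.
have [|y yE] := padic_sqrt_odd lodd _ lx.
  apply: contra la => xl; have x2 : ((val l)%:Z %| x%:Z ^+ 2)%Z by rewrite dvdz_primeX.
  by have := rpredB x2 lx; rewrite subKr.
by apply: (quartic_point_sqr (u := 1) (z := 0) (s := 1)) yE;
  rewrite // ?expr1n ?mul1r ?mulr1 ?mulr0 ?addr0.
Qed.

(** In a primitive solution modulo l^2, if l divided u it would divide w, and dividing by l would
    leave l dividing c z^4, hence z. So u is a unit and a is the square of w/u^2 modulo l. *)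
Lemma quartic_point_odd (a c : int) : odd (val l) ->
  ~~ ((val l)%:Z %| a)%Z -> ~~ ((val l)%:Z %| c)%Z ->
  has_quartic_point (padic l) a%:~R ((val l)%:Z * c)%:~R <->
  is_square (a%:~R : 'F_(val l)).
Proof.
move=> lodd la lc; split; last exact: quartic_point_square.
move=> /(@quartic_primitive l _ _ 2)[u [w [z [uz H]]]].
have lE : ((val l)%:Z %| w ^+ 2 - a * u ^+ 4)%Z.
  have -> : w ^+ 2 - a * u ^+ 4 =
    w ^+ 2 - (a * u ^+ 4 + (val l)%:Z * c * z ^+ 4) + (val l)%:Z * (c * z ^+ 4) by ring.
  rewrite rpredD ?dvdz_mulr //; apply: dvdz_trans H.
  by rewrite -mulnn PoszM dvdz_mulr.
have [lu|lu] := boolP ((val l)%:Z %| u)%Z.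
  have lw : ((val l)%:Z %| w)%Z.
    rewrite -(dvdz_primeX w 1) -(subrK (a * u ^+ 4) (w ^+ 2)) rpredD //.
    by rewrite dvdz_mull // dvdz_primeX.
  exfalso; move: uz; rewrite lu /=; apply/negP; rewrite negbK.
  suff : ((val l)%:Z %| c * z ^+ 4)%Z by rewrite dvdz_primeM (negbTE lc) dvdz_primeX.
  have l0 : (val l)%:Z != 0 by rewrite -lt0n prime_gt0.
  rewrite -(dvdz_mul2l l0).
  have /dvdzP[u' uE] := lu; have /dvdzP[w' wE] := lw.
  have -> : (val l)%:Z * (c * z ^+ 4) = (val l)%:Z * (val l)%:Z *
     (w' ^+ 2 - a * u' ^+ 4 * (val l)%:Z ^+ 2) -
     (w ^+ 2 - (a * u ^+ 4 + (val l)%:Z * c * z ^+ 4)) by rewrite uE wE; ring.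
  by apply: rpredB; [apply: dvdz_mulr | rewrite -PoszM mulnn].
apply/existsP; exists (w%:~R / u%:~R ^+ 2); move: lu lE; rewrite -!Fp_intr_eq0 => u0.
rewrite !(rmorphB, rmorphXn, rmorphM) /= subr_eq0 => /eqP E.
by rewrite expr_div_n E -exprM mulfK // expf_neq0.
Qed.

Hypothesis l2 : val l = 2%N.

Lemma quartic_point_2_sqr (a b u z s m : int) : (u != 0) || (z != 0) ->
  a * u ^+ 4 + b * z ^+ 4 = s ^+ 2 * m -> (m = 1 %[mod 8])%Z ->
  has_quartic_point (padic l) a%:~R b%:~R.
Proof.
by move=> uz E /(padic_sqrt_2 l2)[y yE]; apply: quartic_point_sqr uz E yE.
Qed.

(* Since a^4 = 1 modulo 16, the class c * a^3 solves a * t = c modulo 16. *)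
Lemma quartic_value_surj (a b t : int) : ~~ (2 %| a)%Z -> ~~ (2 %| b)%Z ->
  (a + b = t %[mod 16])%Z ->
  exists2 u : int, u != 0 & exists k : int, a * u ^+ 4 + b = t + 256 * k.
Proof.
move=> a2 b2 abt; pose c := ((t - (a + b)) %/ 16)%Z.
have cE : t - (a + b) = 16 * c by rewrite /c; lia.
have [u u2 uE] := pow4_surj (c * a ^+ 3).
exists u; first by apply: contraNneq u2 => ->.
have [j jE] : exists j, u ^+ 4 = 1 + 16 * (c * a ^+ 3) + 256 * j.
  by exists ((u ^+ 4 - (1 + 16 * (c * a ^+ 3))) %/ 256)%Z; lia.
have [i iE] : exists i, a ^+ 4 = 1 + 16 * i.
  by exists ((a ^+ 4 - 1) %/ 16)%Z; have := pow4_mod16 a; lia.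
exists (a * j + c * i); rewrite jE.
have -> : a * (1 + 16 * (c * a ^+ 3) + 256 * j) + b = a + b + 16 * c * a ^+ 4 + 256 * a * j by ring.
by rewrite iE; lia.
Qed.

(** If just one of u and z is odd, the value is 2 modulo 4 and not a square. If both are, it is 2(a
    + b) modulo 32, and the even squares modulo 32 are 0, 4 and 16. *)
Lemma quartic_point_2_22 (a b : int) : ~~ (2 %| a)%Z -> ~~ (2 %| b)%Z ->
  has_quartic_point (padic l) (2 * a)%:~R (2 * b)%:~R <->
  ((a + b) %% 16)%Z \in [:: 0; 2; 8].
Proof.
move=> a2 b2; split=> [/(@quartic_primitive l _ _ 5)[u [w [z []]]]|].
  have := sqrz_mod32 w; have := mul_pow4_mod16 a u; have := mul_pow4_mod16 b z.
  rewrite l2 -!mulrA; move: (a * u ^+ 4) (b * z ^+ 4) (w ^+ 2) => A B W.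
  have uE : (u %% 2 = 0 \/ u %% 2 = 1)%Z by lia.
have zE : (z %% 2 = 0 \/ z %% 2 = 1)%Z by lia.
case: uE => uE; case: zE => zE; rewrite uE zE !inE => ? ? ? ?; lia.
have sol (t s m : int) : 2 * t = s ^+ 2 * m -> (m = 1 %[mod 8])%Z ->
    (exists k, 512 = s ^+ 2 * (8 * k)) -> (a + b = t %[mod 16])%Z ->
  has_quartic_point (padic l) (2 * a)%:~R (2 * b)%:~R.
  move=> tE m1 [k kE] /(quartic_value_surj a2 b2)[u u0 [j jE]].
  apply: (quartic_point_2_sqr (u := u) (z := 1) (s := s) (m := m + 8 * k * j)); first by rewrite u0.
    transitivity (2 * (a * u ^+ 4 + b)); first by ring.
    have e : 2 * (256 * j) = 512 * j by ring.
    by rewrite jE mulrDr tE e kE; ring.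
  lia.
(* The targets t represent the residues 0, 2, 8 and make 2 t the square of s = 8, 2, 4. Residue 0
   uses all the available precision: 512 = 8 * 8^2, so the quotient by s^2 is known just modulo
   8. *)
rewrite !inE => /or3P[] /eqP H.
- by apply: (sol 32 8 1) => //; exists 1.
- by apply: (sol 2 2 1) => //; exists 16.
- by apply: (sol 8 4 1) => //; exists 4.
Qed.

Lemma quartic_point_2_14 (a b : int) : ~~ (2 %| a)%Z -> ~~ (2 %| b)%Z ->
  has_quartic_point (padic l) a%:~R (4 * b)%:~R <->
  (a = 1 %[mod 4])%Z \/ (b = 1 %[mod 4])%Z.
Proof.
move=> a2 b2; split=> [/(@quartic_primitive l _ _ 4)[u [w [z []]]]|].
  have := sqrz_mod32 w; have := mul_pow4_mod16 a u; have := mul_pow4_mod16 b z.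
  rewrite l2 -!mulrA; move: (a * u ^+ 4) (b * z ^+ 4) (w ^+ 2) => A B W.
  have uE : (u %% 2 = 0 \/ u %% 2 = 1)%Z by lia.
have zE : (z %% 2 = 0 \/ z %% 2 = 1)%Z by lia.
case: uE => uE; case: zE => zE; rewrite uE zE !inE => ? ? ? ?; lia.
have [a1|a1] := eqVneq (a %% 8)%Z 1.
  by move=> _; apply: (quartic_point_2_sqr (u := 1) (z := 0) (s := 1) (m := a));
    rewrite // !expr1n mulr1 mulr0 addr0 mul1r.
have [b1|b1] := eqVneq (b %% 8)%Z 1.
  by move=> _; apply: (quartic_point_2_sqr (u := 0) (z := 1) (s := 2) (m := b));
    rewrite // expr1n mulr0 mulr1 add0r.
(* A coefficient that is 5 modulo 8 becomes 1 modulo 8 when four times the other, odd, coefficient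
   is added; the points (1, 1) and (2, 1) do this for a and for b. *)
case=> H.
  by apply: (quartic_point_2_sqr (u := 1) (z := 1) (s := 1) (m := a + 4 * b));
    rewrite // ?expr1n ?mulr1 ?mul1r //; lia.
by apply: (quartic_point_2_sqr (u := 2) (z := 1) (s := 2) (m := 4 * a + b)) => //; [ring|lia].
Qed.

(** For odd u the value is a modulo 16. For even u, z is odd, w is divisible by 4, and division by
    16 leaves a u'^4 + b z^4 as a square modulo 16; thus the initial precision 2^8. Then b is 1
    modulo 8 if u' is even, and a + b is an even square modulo 16 if u' is odd. *)
Lemma quartic_point_2_116 (a b : int) : ~~ (2 %| a)%Z -> ~~ (2 %| b)%Z ->
  has_quartic_point (padic l) a%:~R (16 * b)%:~R <->
  [\/ (a = 1 %[mod 8])%Z, (b = 1 %[mod 8])%Z | ((a + b) %% 16)%Z \in [:: 0; 4]].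
Proof.
move=> a2 b2; split=> [/(@quartic_primitive l _ _ 8)[u [w [z []]]]|].
  rewrite l2 => uz H.
  have [u1|u0] := boolP (2 %| u)%Z; last first.
    constructor 1; have := sqrz_mod32 w; have := mul_pow4_mod16 a u.
    have -> : (u %% 2)%Z = 1 by lia.
    move: H; rewrite -!mulrA; move: (a * u ^+ 4) (b * z ^+ 4) (w ^+ 2) => A B W.
    by rewrite !inE; lia.
  have [u' uE] : exists u', u = 2 * u' by exists (u %/ 2)%Z; lia.
  have z1 : (z %% 2)%Z = 1 by lia.
  have [w' wE] : exists w', w = 4 * w'.
    exists (w %/ 4)%Z; move: H; rewrite uE.
    have -> : a * (2 * u') ^+ 4 = 16 * (a * u' ^+ 4) by ring.
    rewrite -!mulrA => H.
    have : (w ^+ 2 = 0 %[mod 16])%Z by lia.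
    have [j [r [-> ]]] : exists j r : int, w = 4 * j + r /\ 0 <= r < 4.
      by exists (w %/ 4)%Z, (w %% 4)%Z; split; lia.
    have -> : (4 * j + r) ^+ 2 = 16 * j ^+ 2 + 8 * (j * r) + r ^+ 2 by ring.
    case: r => // r /andP[_ r4].
    by case: r r4 => [|[|[|[|r]]]] //; lia.
  have {}H : (16 %| w' ^+ 2 - (a * u' ^+ 4 + b * z ^+ 4))%Z.
    rewrite -(@dvdz_mul2l 16) //.
    move: H; rewrite uE wE; congr (_ %| _)%Z; ring.
  have := sqrz_mod32 w'; have := mul_pow4_mod16 a u'; have := mul_pow4_mod16 b z.
  rewrite z1; move: H; move: (a * u' ^+ 4) (b * z ^+ 4) (w' ^+ 2) => A B W.
  have [->|->] : (u' %% 2 = 0 \/ u' %% 2 = 1)%Z by lia.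
    by rewrite !inE => *; constructor 2; lia.
  by rewrite !inE => *; constructor 3; lia.
case=> [a1|b1|].
- by apply: (quartic_point_2_sqr (u := 1) (z := 0) (s := 1) (m := a));
    rewrite // !expr1n mulr1 mulr0 addr0 mul1r.
- by apply: (quartic_point_2_sqr (u := 0) (z := 1) (s := 4) (m := b));
    rewrite // expr1n mulr0 mulr1 add0r.
have sol (t s m : int) : t = s ^+ 2 * m -> (m = 1 %[mod 8])%Z ->
    (exists k, 256 = s ^+ 2 * (8 * k)) -> (a + b = t %[mod 16])%Z ->
  has_quartic_point (padic l) a%:~R (16 * b)%:~R.
  move=> tE m1 [k kE] /(quartic_value_surj a2 b2)[u u0 [j jE]].
  apply: (quartic_point_2_sqr (u := 2 * u) (z := 1) (s := 4 * s) (m := m + 8 * k * j)).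
  - by rewrite mulf_neq0.
  - transitivity (16 * (a * u ^+ 4 + b)); first by ring.
    rewrite jE tE kE; ring.
  - lia.
rewrite !inE => /orP[] /eqP H.
  by apply: (sol 16 4 1) => //; exists 2.
by apply: (sol 4 2 1) => //; exists 8.
Qed.

(** At a primitive point the value has 2-adic valuation 1 if u is odd and 3 if u is even, never that
    of a square. *)
Lemma quartic_point_2_28 (a b : int) : ~~ (2 %| a)%Z -> ~~ (2 %| b)%Z ->
  ~ has_quartic_point (padic l) (2 * a)%:~R (8 * b)%:~R.
Proof.
move=> a2 b2 /(@quartic_primitive l _ _ 5)[u [w [z []]]].
have := sqrz_mod32 w; have := mul_pow4_mod16 a u; have := mul_pow4_mod16 b z.
rewrite l2 -!mulrA; move: (a * u ^+ 4) (b * z ^+ 4) (w ^+ 2) => A B W.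
have uE : (u %% 2 = 0 \/ u %% 2 = 1)%Z by lia.
have zE : (z %% 2 = 0 \/ z %% 2 = 1)%Z by lia.
case: uE => uE; case: zE => zE; rewrite uE zE !inE => ? ? ? ?; lia.
Qed.

End LocalPoints.

(** * Selmer groups *)

(** A boolean Legendre symbol for integers, so that it applies to -1 and -q. Multiples of l count as
    squares. *)
Definition qres (l : nat) (a : int) : bool := is_square (a%:~R : 'F_l).

Section Qres.
Variable l : nat.
Hypotheses (lP : prime l) (lodd : odd l).

Lemma Fp_intr_neq0 (a : int) : ~~ (l%:Z %| a)%Z -> a%:~R != 0 :> 'F_l.
Proof. by rewrite (dvdz_pcharf (pchar_Fp lP)). Qed.

Lemma qresM (a b : int) : ~~ (l%:Z %| a)%Z -> ~~ (l%:Z %| b)%Z ->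
  qres l (a * b) = (qres l a == qres l b).
Proof.
move=> /Fp_intr_neq0 la /Fp_intr_neq0 lb.
have := qcharM int a%:~R b%:~R (card_Fp_odd lP lodd).
rewrite /qchar mulf_eq0 (negbTE la) (negbTE lb) /= /qres rmorphM /=.
by case: (is_square _) (is_square _) (is_square _) => [] [] [].
Qed.

Lemma qres_sqr (a : int) : qres l (a ^+ 2).
Proof. by apply/existsP; exists a%:~R; rewrite -rmorphXn. Qed.

Lemma qresN1 : qres l (-1) = (l %% 4 == 1)%N.
Proof. by rewrite /qres rmorphN1 is_squareN1. Qed.

Lemma qres2 : qres l 2 = (l %% 8 == 1)%N || (l %% 8 == 7)%N.
Proof. by rewrite /qres -is_square2. Qed.

Lemma legendreE (a : nat) : ~~ (l %| a)%N -> legendre a l = if qres l a then 1 else -1.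
Proof.
move=> la; rewrite /legendre (negbTE la) /qres -pmulrn.
congr (if _ then _ else _); apply/existsP/existsP => -[x /eqP xE].
  exists (x : nat)%:R; rewrite -natrX; apply/eqP/val_inj.
  by rewrite /= !val_Fp_nat.
have xl : (x < l)%N by rewrite -[X in (_ < X)%N](Fp_cast lP).
exists (Ordinal xl); apply/eqP => /=; rewrite -!(val_Fp_nat lP) natrX.
by rewrite natr_Zp xE.
Qed.

End Qres.

(** Lets scaling arguments treat R and the fields Q_l uniformly. *)
Lemma completion_ratr (R : realType) (v : place) :
  exists f : {rmorphism rat -> completion R v}, f =1 ratr.
Proof.
case: v => [|l].
  by exists (ratr : {rmorphism rat -> R}).
by exists (padic_of_rat l : {rmorphism rat -> padic l}) => x; rewrite ratr_padic.
Qed.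

Lemma quartic_point_scale (K : fieldType) (f : {rmorphism rat -> K}) (a b r : rat) :
  r != 0 -> has_quartic_point K a b -> has_quartic_point K (a * r ^+ 2) (b / r ^+ 2).
Proof.
move=> r0 [u [w [z [nz E]]]]; have fr0 : f r != 0 by rewrite fmorph_eq0.
exists u, (f r * w), (f r * z); split.
  move=> [u0 /eqP + /eqP]; rewrite !mulf_eq0 (negbTE fr0) => /eqP w0 /eqP z0.
  by apply: nz; rewrite u0 w0 z0.
rewrite exprMn E -!(fmorph_eq_rat f) fmorph_div rmorphM !rmorphXn.
by field.
Qed.

Lemma sqclass_ofP (d e : rat) : d != 0 -> e != 0 ->
  sqclass_of d = sqclass_of e <-> exists2 r : rat, r != 0 & d = r ^+ 2 * e.
Proof.
move=> d0 e0; rewrite /sqclass_of; split=> [/eqP|[r r0 E]]; last apply/eqP.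
  by rewrite -[_ == _]/(_ == _ %[mod sqclass])%qT eqmodE => /asboolP; rewrite !insubdK.
rewrite -[_ == _]/(_ == _ %[mod sqclass])%qT eqmodE; apply/asboolP.
by rewrite !insubdK //; exists r.
Qed.

Lemma in_selmer (R : realType) (p q : nat) (c d : rat) : d != 0 ->
  selmer R p q c (sqclass_of d) <->
  QS2 p q (sqclass_of d) /\
  forall v, in_S p q v -> has_quartic_point (completion R v) d (c / d).
Proof.
move=> d0; split=> [[e [e0 [eS H]] E]|[dS H]]; last by exists d.
split; first by rewrite -E.
have /(sqclass_ofP d0 e0)[r r0 dE] := esym E.
move=> v /H P; have [f _] := completion_ratr R v.
have := quartic_point_scale f r0 P; rewrite mulrC -dE.
by have -> : c / e / r ^+ 2 = c / d by rewrite dE; field; apply/andP.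
Qed.

(** The least prime factor has a positive even exponent, so its square can be split off and
    induction applies to the quotient. *)
Lemma logn_even_square (x : nat) : (0 < x)%N ->
  (forall l, prime l -> ~~ odd (logn l x)) -> exists n, x = (n ^ 2)%N.
Proof.
elim/ltn_ind: x => x IH x0 H; have [x1|x1] := leqP x 1.
  by exists 1%N; lia.
have lP := pdiv_prime x1; set l := pdiv x in lP.
have : (l ^ 2 %| x)%N.
  rewrite pfactor_dvdn //; have := H l lP.
  have : (0 < logn l x)%N by rewrite -pfactor_dvdn // expn1 pdiv_dvd.
  by case: (logn l x) => [|[]].
move=> /dvdnP[y yE]; have l2 : (0 < l ^ 2)%N by rewrite expn_gt0 prime_gt0.
have y0 : (0 < y)%N by move: x0; rewrite yE muln_gt0 => /andP[].
have [|//||n nE] := IH y.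
- by rewrite yE ltn_Pmulr // -[1%N]/(1 ^ 2)%N ltn_exp2r ?prime_gt1.
- move=> k kP; have := H k kP; rewrite yE lognM // lognX oddD.
  by rewrite mul2n odd_double addbF.
by exists (n * l)%N; rewrite yE nE expnMn.
Qed.

(** * Representatives of Q(S,2) *)

Section SquareClasses.
Variables p q : nat.
Hypotheses (pP : prime p) (qP : prime q) (podd : odd p) (qodd : odd q) (pq : p != q).

(* Booleans serve as exponents 0 and 1. *)
Definition class_rep (s i j k : bool) : int :=
  (-1) ^+ s * (2 ^ i * p ^ j * q ^ k)%N%:Z.

Lemma class_rep_neq0 s i j k : class_rep s i j k != 0.
Proof.
by rewrite mulf_neq0 ?signr_eq0 // -lt0n !muln_gt0 !expn_gt0 !prime_gt0.
Qed.

Lemma logn_class_rep l (i j k : bool) : prime l -> logn l (2 ^ i * p ^ j * q ^ k) =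
  ((l == 2) && i + ((l == p) && j) + ((l == q) && k))%N.
Proof.
move=> lP; rewrite !lognM ?muln_gt0 ?expn_gt0 ?prime_gt0 // !lognX !logn_prime //.
by case: (l == 2) (l == p) (l == q) i j k => [] [] [] [] [] [].
Qed.

Lemma ordq_class_rep l s i j k : prime l -> ordq l (class_rep s i j k)%:~R =
  ((l == 2) && i + ((l == p) && j) + ((l == q) && k))%N.
Proof.
move=> lP; rewrite -logn_class_rep // /ordq numq_int denq_int logn1 subr0.
by rewrite /class_rep abszMsign.
Qed.

Lemma QS2_class_rep s i j k : QS2 p q (sqclass_of (class_rep s i j k)%:~R).
Proof.
exists (class_rep s i j k)%:~R => //; split; first by rewrite intr_eq0 class_rep_neq0.
move=> l; rewrite /in_S !inE !negb_or => /and3P[l2 lp lq].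
by rewrite ordq_class_rep ?(valP l) // (negbTE l2) (negbTE lp) (negbTE lq).
Qed.

Lemma QS2_classP x : QS2 p q x ->
  exists s i j k, x = sqclass_of (class_rep s i j k)%:~R.
Proof.
have even_sub (a b : nat) : (2 %| a%:Z - b%:Z)%Z -> ~~ odd (a + b).
  by clear; lia.
case=> d [d0 dS] <-.
(* Up to sign, d is N divided by the square of its denominator. M collects the primes of odd
   exponent in N, so N M has only even exponents and is a square n^2. *)
pose N := (`|numq d| * `|denq d|)%N.
have N0 : (0 < N)%N by rewrite muln_gt0 !absz_gt0 numq_eq0 d0 denq_neq0.
pose i := odd (logn 2 N); pose j := odd (logn p N); pose k := odd (logn q N).
pose M := (2 ^ i * p ^ j * q ^ k)%N.
have M0 : (0 < M)%N by rewrite !muln_gt0 !expn_gt0 !prime_gt0.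
have NM0 : (0 < N * M)%N by rewrite muln_gt0 N0.
have [l lP|n nE] := logn_even_square NM0.
  rewrite lognM // oddD logn_class_rep //.
  have [l2|l2] := eqVneq l 2%N.
    rewrite l2 [2 == p]eq_sym [2 == q]eq_sym.
    have -> : (p == 2) = false by apply: contraTF podd => /eqP->.
    have -> : (q == 2) = false by apply: contraTF qodd => /eqP->.
    by rewrite !addn0 /i; case: (odd (logn 2 N)).
  have [lp|lp] := eqVneq l p.
    by rewrite lp (negbTE pq) /= addn0 /j; case: (odd (logn p N)).
  have [lq|lq] := eqVneq l q.
    by rewrite lq /= /k; case: (odd (logn q N)).
  rewrite /= addbF.
  have := dS (exist _ l lP); rewrite /in_S !inE /= !negb_or l2 lp lq => /(_ isT).
  by rewrite /N lognM ?absz_gt0 ?numq_eq0 ?denq_neq0 //; apply: even_sub.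
exists (d < 0), i, j, k; apply/sqclass_ofP => //; first by rewrite intr_eq0 class_rep_neq0.
have n0 : (n%:R != 0 :> rat).
  by rewrite pnatr_eq0; apply: contraTneq NM0 => n0; rewrite nE n0.
have M0' : (M%:R != 0 :> rat) by rewrite pnatr_eq0 -lt0n.
have dd0 : (denq d)%:~R != 0 :> rat by rewrite intr_eq0 denq_neq0.
(* With D the denominator, |d| = N/D^2 = n^2/(M D^2) = (n/(M D))^2 M. *)
exists (n%:R / M%:R / (denq d)%:~R).
  by rewrite !mulf_neq0 ?invr_eq0.
pose A := `|numq d|%N; pose D := `|denq d|%N.
have DE : (denq d)%:~R = D%:R :> rat by rewrite -(absz_denq d) -pmulrn.
have nE' : n%:R ^+ 2 = A%:R * D%:R * M%:R :> rat by rewrite -natrX -nE !natrM.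
rewrite -{1}[d]divq_num_den (intEsign (numq d)) numq_lt0 intrM rmorph_sign /= -/A.
rewrite DE in dd0 *; rewrite !exprMn nE' /class_rep -/M intrM rmorph_sign -!pmulrn.
by field; rewrite M0' dd0.
Qed.

End SquareClasses.

(** * Solubility at all places of S *)

Section EverywhereLocal.
Variables (R : realType) (p q : nat).
Hypotheses (pP : prime p) (qP : prime q) (podd : odd p) (qodd : odd q) (pq : p != q).

Definition everywhere_soluble (a b : int) : Prop :=
  forall v, in_S p q v -> has_quartic_point (completion R v) a%:~R b%:~R.

Lemma everywhere_solubleC a b : everywhere_soluble a b <-> everywhere_soluble b a.
Proof. by split=> H v /H /has_quartic_pointC. Qed.

(** Rescaling w and z moves a square factor between the coefficients. Together with the exchange of
    u and z, this identifies the quartics of complementary classes. *)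
Lemma everywhere_soluble_scale a b r : r != 0 ->
  everywhere_soluble (a * r ^+ 2) b <-> everywhere_soluble a (b * r ^+ 2).
Proof.
move=> r0; have r0' : r%:~R != 0 :> rat by rewrite intr_eq0.
suff S c d : everywhere_soluble (c * r ^+ 2) d -> everywhere_soluble c (d * r ^+ 2).
  by split=> [/S //|/everywhere_solubleC/S/everywhere_solubleC].
move=> H v vS; have [f _] := completion_ratr R v.
have := quartic_point_scale f (invr_neq0 r0') (H v vS).
rewrite !(rmorphXn, rmorphM) /= exprVn mulfK ?expf_neq0 // invrK.
by [].
Qed.

Lemma in_selmer_int (c e f : int) : e != 0 -> e * f = c ->
  selmer R p q c%:~R (sqclass_of e%:~R) <->
  QS2 p q (sqclass_of e%:~R) /\ everywhere_soluble e f.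
Proof.
move=> e0 <-; have e0' : e%:~R != 0 :> rat by rewrite intr_eq0.
by rewrite in_selmer // rmorphM /= mulrAC divff // mul1r.
Qed.

Lemma real_quartic_point (a b : int) : a != 0 -> b != 0 ->
  has_quartic_point R a%:~R b%:~R <-> (0 < a) || (0 < b).
Proof.
move=> a0 b0; split=> [[u [w [z [nz]]]]|].
  rewrite !ratr_int => E; rewrite -[0 < a]negbK -[0 < b]negbK -negb_and -!leNgt.
  apply/negP => /andP[a_le b_le].
  have aR : a%:~R < 0 :> R by rewrite ltrz0 lt_neqAle a0.
  have bR : b%:~R < 0 :> R by rewrite ltrz0 lt_neqAle b0.
  have u4 : 0 <= u ^+ 4 by rewrite exprn_even_ge0.
  have z4 : 0 <= z ^+ 4 by rewrite exprn_even_ge0.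
  have w2 : 0 <= w ^+ 2 by rewrite sqr_ge0.
  have au : a%:~R * u ^+ 4 <= 0 by rewrite nmulr_rle0.
  have bz : b%:~R * z ^+ 4 <= 0 by rewrite nmulr_rle0.
  have w0 : w ^+ 2 = 0 by lra.
  have au0 : a%:~R * u ^+ 4 = 0 by lra.
  have bz0 : b%:~R * z ^+ 4 = 0 by lra.
  have pow0 (c x : R) : c < 0 -> c * x ^+ 4 = 0 -> x = 0.
    by move=> c0 /eqP; rewrite mulf_eq0 (lt_eqF c0) expf_eq0 => /eqP.
  apply: nz; rewrite (pow0 _ _ aR au0) (pow0 _ _ bR bz0).
  by move/eqP: w0; rewrite sqrf_eq0 => /eqP->.
have nz1 : 1 != 0 :> R by rewrite oner_eq0.
case/orP=> c0.
  exists 1, (Num.sqrt a%:~R), 0; split; first by case=> one0; rewrite one0 eqxx in nz1.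
  by rewrite !ratr_int sqr_sqrtr ?ler0z ?ltW // expr1n expr0n mulr0 addr0 mulr1.
exists 0, (Num.sqrt b%:~R), 1; split; first by case=> _ one0; rewrite one0 eqxx in nz1.
by rewrite !ratr_int sqr_sqrtr ?ler0z ?ltW // expr1n expr0n mulr0 add0r mulr1.
Qed.

Let two : prime_nat := exist _ 2 isT.
Let pp : prime_nat := exist _ p pP.
Let qq : prime_nat := exist _ q qP.

Lemma everywhere_solubleP a b : a != 0 -> b != 0 -> everywhere_soluble a b <->
  [/\ (0 < a) || (0 < b), has_quartic_point (padic two) a%:~R b%:~R,
      has_quartic_point (padic pp) a%:~R b%:~R &
      has_quartic_point (padic qq) a%:~R b%:~R].
Proof.
move=> a0 b0; split=> [H|[/(real_quartic_point a0 b0) HR H2 Hp Hq]].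
  split; first exact/(real_quartic_point a0 b0)/(H InfinitePlace).
  - by apply: (H (FinitePlace two)); rewrite /in_S !inE.
  - by apply: (H (FinitePlace pp)); rewrite /in_S !inE eqxx orbT.
  - by apply: (H (FinitePlace qq)); rewrite /in_S !inE eqxx !orbT.
case=> [|l] //; rewrite /in_S !inE => /or3P[] /eqP lE.
- by have -> : l = two by apply: val_inj.
- by have -> : l = pp by apply: val_inj.
- by have -> : l = qq by apply: val_inj.
Qed.

Local Notation P := (p%:Z).
Local Notation Q := (q%:Z).

Let dvdpM m n : (P %| m * n)%Z = (P %| m)%Z || (P %| n)%Z := @dvdz_primeM pp m n.
Let dvdqM m n : (Q %| m * n)%Z = (Q %| m)%Z || (Q %| n)%Z := @dvdz_primeM qq m n.

Let dvdzN (m n : int) : (m %| - n)%Z = (m %| n)%Z.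
Proof. by rewrite !dvdzE abszN. Qed.
Let p2 : (P %| 2)%Z = false.
Proof. by rewrite dvdzE /= dvdn_prime2 //; apply: contraTF podd => /eqP->. Qed.
Let q2 : (Q %| 2)%Z = false.
Proof. by rewrite dvdzE /= dvdn_prime2 //; apply: contraTF qodd => /eqP->. Qed.
Let p1 : (P %| 1)%Z = false.
Proof. by rewrite dvdzE /= Euclid_dvd1. Qed.
Let q1 : (Q %| 1)%Z = false.
Proof. by rewrite dvdzE /= Euclid_dvd1. Qed.
Let pdq : (P %| Q)%Z = false.
Proof. by rewrite dvdzE /= dvdn_prime2 // (negbTE pq). Qed.
Let qdp : (Q %| P)%Z = false.
Proof. by rewrite dvdzE /= dvdn_prime2 // eq_sym (negbTE pq). Qed.
Let p0 : P != 0. Proof. by rewrite -lt0n prime_gt0. Qed.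
Let q0 : Q != 0. Proof. by rewrite -lt0n prime_gt0. Qed.
Let p2' : ~~ (2 %| P)%Z. Proof. lia. Qed.
Let q2' : ~~ (2 %| Q)%Z. Proof. lia. Qed.
Let pq2' : ~~ (2 %| P * Q)%Z. Proof. by rewrite -PoszM dvdzE /= dvdn2 oddM podd qodd. Qed.

Let at_p a c : (P %| a)%Z = false -> (P %| c)%Z = false ->
  has_quartic_point (padic pp) a%:~R (P * c)%:~R <-> qres p a.
Proof. by move=> pa pc; apply: (@quartic_point_odd pp) => //=; rewrite ?pa ?pc. Qed.

Let at_q a c : (Q %| a)%Z = false -> (Q %| c)%Z = false ->
  has_quartic_point (padic qq) a%:~R (Q * c)%:~R <-> qres q a.
Proof. by move=> pa pc; apply: (@quartic_point_odd qq) => //=; rewrite ?pa ?pc. Qed.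

Lemma soluble_2_2pq : everywhere_soluble 2 (2 * (P * Q)) <->
  [/\ qres p 2, qres q 2 & ((1 + P * Q) %% 16)%Z \in [:: 0; 2; 8]].
Proof.
rewrite everywhere_solubleP ?mulf_neq0 //.
have := @quartic_point_2_22 two erefl 1 (P * Q) isT pq2'; rewrite mulr1 => E2.
have := @at_p 2 (2 * Q) p2; rewrite dvdpM p2 pdq mulrCA => /(_ erefl) Ep.
have := @at_q 2 (2 * P) q2; rewrite dvdqM q2 qdp mulrCA [Q * P]mulrC => /(_ erefl) Eq.
by split=> [[_ /E2 ? /Ep ? /Eq ?]|[/Ep ? /Eq ? /E2 ?]].
Qed.

Lemma soluble_p_4q : everywhere_soluble P (4 * Q) <->
  [/\ qres p Q, qres q P & (P = 1 %[mod 4])%Z \/ (Q = 1 %[mod 4])%Z].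
Proof.
rewrite everywhere_solubleP ?mulf_neq0 //.
have E2 := @quartic_point_2_14 two erefl P Q p2' q2'.
have := @at_p (2 ^+ 2 * Q) 1; rewrite mulr1 !dvdpM p2 pdq => /(_ erefl p1).
rewrite qresM // ?dvdpM ?p2 ?pdq // qres_sqr // => Ep.
have := @at_q P (2 * 2) qdp; rewrite dvdqM q2 mulrC => /(_ erefl) Eq.
split=> [[_ /E2 ? /has_quartic_pointC/Ep ? /Eq ?]|[? /Eq ? /E2 ?]] //.
by split=> //; [rewrite ltz_nat prime_gt0|apply/has_quartic_pointC/Ep].
Qed.

Lemma soluble_2p_2q : everywhere_soluble (2 * P) (2 * Q) <->
  [/\ qres p (2 * Q), qres q (2 * P) & ((P + Q) %% 16)%Z \in [:: 0; 2; 8]].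
Proof.
rewrite everywhere_solubleP ?mulf_neq0 //.
have E2 := @quartic_point_2_22 two erefl P Q p2' q2'.
have := @at_p (2 * Q) 2; rewrite !dvdpM p2 pdq [P * 2]mulrC => /(_ erefl erefl) Ep.
have := @at_q (2 * P) 2; rewrite !dvdqM q2 qdp [Q * 2]mulrC => /(_ erefl erefl) Eq.
split=> [[_ /E2 ? /has_quartic_pointC/Ep ? /Eq ?]|[? /Eq ? /E2 ?]] //.
by split=> //; [rewrite pmulr_rgt0 // ltz_nat prime_gt0|apply/has_quartic_pointC/Ep].
Qed.

Lemma soluble_N1_16pq : everywhere_soluble (-1) (16 * (P * Q)) <->
  [/\ qres p (-1), qres q (-1) & (P * Q = 1 %[mod 8])%Z \/
     ((-1 + P * Q) %% 16)%Z \in [:: 0; 4]].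
Proof.
rewrite everywhere_solubleP ?mulf_neq0 //.
have E2 := @quartic_point_2_116 two erefl (-1) (P * Q) isT pq2'.
have := @at_p (-1) (2 ^+ 4 * Q); rewrite !dvdpM p2 pdq dvdzN p1 mulrCA => /(_ erefl erefl) Ep.
have := @at_q (-1) (2 ^+ 4 * P).
rewrite !dvdqM q2 qdp dvdzN q1 mulrCA [Q * P]mulrC => /(_ erefl erefl) Eq.
split=> [[_ /E2 H /Ep ? /Eq ?]|[/Ep ? /Eq ? H]].
  by split=> //; case: H => //; auto.
split=> //; last by apply/E2; case: H => H; [constructor 2|constructor 3].
by rewrite pmulr_rgt0 // -PoszM ltz_nat muln_gt0 !prime_gt0.
Qed.

Lemma soluble_p_N16q : everywhere_soluble P (16 * - Q) <->
  [/\ qres p (- Q), qres q P &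
  [\/ (P = 1 %[mod 8])%Z, (- Q = 1 %[mod 8])%Z | ((P - Q) %% 16)%Z \in [:: 0; 4]]].
Proof.
rewrite everywhere_solubleP ?mulf_neq0 ?oppr_eq0 //.
have Nq2 : ~~ (2 %| - Q)%Z by rewrite dvdzN.
have E2 := @quartic_point_2_116 two erefl P (- Q) p2' Nq2.
have := @at_p (4 ^+ 2 * - Q) 1; rewrite mulr1 !dvdpM dvdzN pdq.
rewrite (_ : 4 = 2 * 2) // dvdpM p2 => /(_ erefl p1).
rewrite qresM // ?dvdpM ?dvdzN ?p2 ?pdq // qres_sqr // => Ep.
have := @at_q P (- (2 * 2) ^+ 2) qdp; rewrite dvdzN !dvdqM q2 mulrN -mulNr mulrC => /(_ erefl) Eq.
split=> [[_ /E2 ? /has_quartic_pointC/Ep ? /Eq ?]|[? /Eq ? /E2 ?]] //.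
by split=> //; [rewrite ltz_nat prime_gt0|apply/has_quartic_pointC/Ep].
Qed.

Lemma not_soluble_2_8 a b : ~~ (2 %| a)%Z -> ~~ (2 %| b)%Z ->
  ~ everywhere_soluble (2 * a) (8 * b).
Proof.
move=> a2 b2 H; apply: (@quartic_point_2_28 two erefl _ _ a2 b2).
by apply: (H (FinitePlace two)); rewrite /in_S !inE.
Qed.

End EverywhereLocal.

(** * Reduction of both Selmer groups to six quartics *)

Section SelmerGroups.
Variables (R : realType) (p q : nat).
Hypotheses (pP : prime p) (qP : prime q) (podd : odd p) (qodd : odd q) (pq : p != q).

Local Notation P := (p%:Z).
Local Notation Q := (q%:Z).
Local Notation rep := (class_rep p q).
Local Notation ES := (@everywhere_soluble R p q).

(** The sign and the parities of the valuations at 2, p and q are invariants of the square class. *)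
Lemma class_rep_inj s i j k s' i' j' k' :
  sqclass_of (rep s i j k)%:~R = sqclass_of (rep s' i' j' k')%:~R ->
  (s, i, j, k) = (s', i', j', k').
Proof.
have r0 s1 i1 j1 k1 : (rep s1 i1 j1 k1)%:~R != 0 :> rat by rewrite intr_eq0 class_rep_neq0.
move=> /(sqclass_ofP (r0 _ _ _ _) (r0 _ _ _ _))[r rn0 E].
have ordE l : prime l -> ordq l (rep s i j k)%:~R =
    ordq l r + ordq l r + ordq l (rep s' i' j' k')%:~R.
  by move=> lP; rewrite E !ordqM // mulf_neq0.
have neg s1 i1 j1 k1 : (rep s1 i1 j1 k1 < 0) = s1.
  rewrite /class_rep pmulr_llt0 ?signr_lt0 //.
  by rewrite ltz_nat !muln_gt0 !expn_gt0 !prime_gt0.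
have <- : s = s'.
  rewrite -(neg s i j k) -(neg s' i' j' k') -!(ltrz0 rat) E.
  by rewrite pmulr_rlt0 // exprn_even_gt0.
have p2 : (p == 2) = false by apply: contraTF podd => /eqP->.
have q2 : (q == 2) = false by apply: contraTF qodd => /eqP->.
have := ordE 2%N isT; have := ordE p pP; have := ordE q qP.
rewrite !ordq_class_rep // !eqxx [2 == p]eq_sym [2 == q]eq_sym p2 q2.
rewrite [q == p]eq_sym (negbTE pq) /=.
have parity (x : int) (b1 b2 : bool) : b1%:Z = x + x + b2%:Z -> b1 = b2.
  by clear; case: b1 b2 => [] [] //; lia.
by rewrite !addn0 !add0n => /parity-> /parity-> /parity->.
Qed.

Lemma selmer_eqP (c : rat) (s : bool) :
  selmer R p q c = [set sqclass_of (rep false false false false)%:~R;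
                        sqclass_of (rep s false true true)%:~R]%classic <->
  forall s' i j k, selmer R p q c (sqclass_of (rep s' i j k)%:~R) <->
    (s', i, j, k) = (false, false, false, false) \/ (s', i, j, k) = (s, false, true, true).
Proof.
split=> [-> s' i j k|H].
  split=> [[] /class_rep_inj ->|[] [-> -> -> ->]]; by [left|right].
apply/seteqP; split=> x.
  move=> xS; have : QS2 p q x by case: xS => d [_ [dS _]] <-.
  move=> /(QS2_classP pP qP podd qodd pq)[s' [i [j [k xE]]]].
  by move: xS; rewrite xE => /H[] [-> -> -> ->]; [left|right].
by case=> ->; apply/H; [left|right].
Qed.

(* The coefficient complementary to [class_rep]: their product is 2^n p q. *)
Definition class_corep n (s i j k : bool) : int :=
  (-1) ^+ s * (2 ^ (n - i) * p ^ (1 - j) * q ^ (1 - k))%N%:Z.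

Lemma class_rep_corep n (s i j k : bool) : (0 < n)%N ->
  rep s i j k * class_corep n s i j k = (2 ^ n * p * q)%N%:Z.
Proof.
move=> n0; rewrite /class_rep /class_corep mulrACA -expr2 sqrr_sign mul1r -PoszM.
have -> : (2 ^ n = 2 ^ i * 2 ^ (n - i))%N by rewrite -expnD subnKC //; case: (i).
have -> : (2 ^ i * p ^ j * q ^ k * (2 ^ (n - i) * p ^ (1 - j) * q ^ (1 - k)) =
  2 ^ i * 2 ^ (n - i) * (p ^ j * p ^ (1 - j)) * (q ^ k * q ^ (1 - k)))%N by lia.
by rewrite -[(p ^ j * _)%N]expnD -[(q ^ k * _)%N]expnD !subnKC ?expn1 //; [case: (k)|case: (j)].
Qed.

Lemma selmer_phi_rep s i j k :
  selmer_phi R p q (sqclass_of (rep s i j k)%:~R) <->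
  ES (rep s i j k) (class_corep 2 s i j k).
Proof.
rewrite /selmer_phi pmulrn.
have E : rep s i j k * class_corep 2 s i j k = (4 * p * q)%N%:Z by rewrite class_rep_corep.
rewrite (@in_selmer_int R p q _ _ _ (class_rep_neq0 pP qP s i j k) E).
by split=> [[]|H] //; split=> //; apply: QS2_class_rep.
Qed.

Lemma selmer_phihat_rep s i j k :
  selmer_phihat R p q (sqclass_of (rep s i j k)%:~R) <->
  ES (rep s i j k) (- class_corep 4 s i j k).
Proof.
rewrite /selmer_phihat pmulrn -rmorphN /=.
have E : rep s i j k * - class_corep 4 s i j k = - (16 * p * q)%N%:Z.
  by rewrite mulrN class_rep_corep.
rewrite (@in_selmer_int R p q _ _ _ (class_rep_neq0 pP qP s i j k) E).
by split=> [[]|H] //; split=> //; apply: QS2_class_rep.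
Qed.

Let repE s i j k : rep s i j k = (if s then -1 else 1) * (if i then 2 else 1) *
  (if j then P else 1) * (if k then Q else 1).
Proof.
by rewrite /class_rep; case: s i j k => [] [] [] [];
  rewrite ?expn0 ?expn1 ?expr0 ?expr1; lia.
Qed.

Let corepE s i j k : class_corep 2 s i j k = (if s then -1 else 1) * (if i then 2 else 4) *
  (if j then 1 else P) * (if k then 1 else Q).
Proof.
by rewrite /class_corep; case: s i j k => [] [] [] [];
  rewrite /= ?subn0 ?subnn ?subn1 /= ?expn0 ?expn1 ?expr0 ?expr1; lia.
Qed.

Let corep4E s i j k : class_corep 4 s i j k = (if s then -1 else 1) * (if i then 8 else 16) *
  (if j then 1 else P) * (if k then 1 else Q).
Proof.
by rewrite /class_corep; case: s i j k => [] [] [] [];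
  rewrite /= ?subn0 ?subnn ?subn1 /= ?expn0 ?expn1 ?expr0 ?expr1; lia.
Qed.

Lemma everywhere_soluble_1 b : ES 1 b.
Proof.
move=> v _; have [f fE] := completion_ratr R v; exists 1, 1, 0; split; last first.
  by rewrite -!fE rmorph1 !expr1n expr0n mulr0 addr0 mulr1.
by case=> /eqP; rewrite oner_eq0.
Qed.

Lemma not_everywhere_soluble_neg a b : a < 0 -> b < 0 -> ~ ES a b.
Proof.
move=> a0 b0 /(_ InfinitePlace isT).
move=> /(real_quartic_point R (ltr0_neq0 a0) (ltr0_neq0 b0)).
by rewrite !ltNge (ltW a0) (ltW b0).
Qed.

Let scale r a b : r != 0 -> ES (r ^+ 2 * a) b <-> ES a (r ^+ 2 * b).
Proof.
by move=> r0; rewrite ![r ^+ 2 * _]mulrC; apply: everywhere_soluble_scale.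
Qed.

(** Negative d fail over R, both coefficients being negative. The positive classes pair off as {1,
    pq}, {2, 2pq}, {p, q}, {2p, 2q}, and the first pair always has the point (1, 1, 0) up to
    exchange and scaling. *)
Lemma selmer_phi_trivial :
  selmer_phi R p q = [set sqclass_of 1; sqclass_of (p * q)%:R]%classic <->
  [/\ ~ ES 2 (2 * (P * Q)), ~ ES P (4 * Q) & ~ ES (2 * P) (2 * Q)].
Proof.
have scale2 a b : ES (4 * a) b <-> ES a (4 * b) by apply: (@scale 2).
have -> : 1 = (rep false false false false)%:~R :> rat by rewrite repE.
have -> : (p * q)%:R = (rep false false true true)%:~R :> rat.
  by rewrite repE !mul1r -PoszM -pmulrn.
rewrite selmer_eqP -/(selmer_phi R p q); split=> [H|[nA nB nC] s i j k].
  split=> E.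
  - have [|//|//] := (H false true false false).1.
    by apply/selmer_phi_rep; rewrite repE corepE /= !mulr1 !mul1r -mulrA.
  - have [|//|//] := (H false false true false).1.
    by apply/selmer_phi_rep; rewrite repE corepE /= !mulr1 !mul1r.
  - have [|//|//] := (H false true true false).1.
    by apply/selmer_phi_rep; rewrite repE corepE /= !mulr1 !mul1r.
rewrite selmer_phi_rep; case: s.
  split; last by case.
  move=> /not_everywhere_soluble_neg; case.
    by rewrite /class_rep mulN1r oppr_lt0 ltz_nat !muln_gt0 !expn_gt0 !prime_gt0.
  by rewrite /class_corep mulN1r oppr_lt0 ltz_nat !muln_gt0 !expn_gt0 !prime_gt0.
rewrite repE corepE; case: i j k => [] [] [];
  rewrite /= ?mulr1 ?mul1r; split => //; try by case.
- by rewrite everywhere_solubleC -mulrA => /nA.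
- by rewrite everywhere_solubleC => /nC.
- by rewrite -mulrA => /nA.
- by right.
- by move=> _; rewrite -[4]mulr1 -scale2; apply/everywhere_solubleC/everywhere_soluble_1.
- by rewrite everywhere_solubleC scale2 => /nB.
- by left.
- by move=> _; apply: everywhere_soluble_1.
Qed.

(** For even d the coefficients are 2a and 8b with a and b odd, which is insoluble at 2. The odd
    classes pair off as {1, -pq}, {-1, pq}, {p, -q}, {q, -p}. *)
Lemma selmer_phihat_trivial :
  selmer_phihat R p q = [set sqclass_of 1; sqclass_of (- (p * q)%:R)]%classic <->
  [/\ ~ ES (-1) (16 * (P * Q)), ~ ES P (16 * - Q) & ~ ES Q (16 * - P)].
Proof.
have scale4 a b : ES (16 * a) b <-> ES a (16 * b) by apply: (@scale 4).
have -> : 1 = (rep false false false false)%:~R :> rat by rewrite repE.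
have -> : - (p * q)%:R = (rep true false true true)%:~R :> rat.
  by rewrite repE mulr1 mulN1r mulNr -PoszM rmorphN.
rewrite selmer_eqP -/(selmer_phihat R p q); split=> [H|[nD nE nF] s i j k].
  split=> E.
  - have [|//|//] := (H true false false false).1.
    apply/selmer_phihat_rep; rewrite repE corep4E /= !mulr1 !mulN1r !mulNr opprK.
    by rewrite -mulrA.
  - have [|//|//] := (H false false true false).1.
    by apply/selmer_phihat_rep; rewrite repE corep4E /= !mulr1 !mul1r -mulrN.
  - have [|//|//] := (H false false false true).1.
    by apply/selmer_phihat_rep; rewrite repE corep4E /= !mulr1 !mul1r -mulrN.
rewrite selmer_phihat_rep; case: i.
  split; last by case.
  have oddM' a b : ~~ (2 %| a)%Z -> ~~ (2 %| b)%Z -> ~~ (2 %| a * b)%Z.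
    by rewrite !dvdzE abszM /= Euclid_dvdM // negb_or => -> ->.
  have odd_if (b : bool) (m n : int) : ~~ (2 %| m)%Z -> ~~ (2 %| n)%Z ->
    ~~ (2 %| if b then m else n)%Z by case: b.
  have p2 : ~~ (2 %| P)%Z by rewrite dvdzE /= dvdn2 podd.
  have q2 : ~~ (2 %| Q)%Z by rewrite dvdzE /= dvdn2 qodd.
  move=> E; exfalso; move: E; rewrite repE corep4E.
  rewrite [_ * 2]mulrC [_ * 8]mulrC -!mulrA -mulrN.
  apply: not_soluble_2_8.
    by apply: (oddM' _ _); [apply: odd_if | apply: (oddM' _ _); apply: odd_if].
  by rewrite -mulNr; apply: (oddM' _ _); [case: (s) | apply: (oddM' _ _); apply: odd_if].
rewrite repE corep4E; case: s j k => [] [] [];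
  rewrite /= ?mulr1 ?mul1r ?mulN1r ?mulNr ?opprK; split => //; try (by case);
  rewrite -?[16 * P * Q]mulrA -?[- (16 * P)]mulrN -?[- (16 * Q)]mulrN.
- by right.
- move=> _; apply/everywhere_solubleC; rewrite -[16]mulr1 scale4.
  exact: everywhere_soluble_1.
- by rewrite everywhere_solubleC scale4 => /nF.
- by rewrite everywhere_solubleC scale4 => /nE.
- by move/nD.
- by rewrite everywhere_solubleC (_ : - 16 = 16 * - 1) // scale4 => /nD.
- by move/nE.
- by move/nF.
- by left.
- by move=> _; apply: everywhere_soluble_1.
Qed.

End SelmerGroups.

(** * Comparison of the conditions *)

Lemma mod16_two_square (m n : nat) : (m = n %[mod 16])%N ->
  ((1 + m%:Z) %% 16)%Z \in [:: 0; 2; 8] = ((1 + n) %% 16 \in [:: 0; 2; 8])%N.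
Proof.
move=> mn; rewrite -[1 + m%:Z]/((1 + m)%N%:Z) modz_nat !inE !eqz_nat.
by rewrite -modnDmr mn modnDmr.
Qed.

Lemma mod16_sum_two_square (m n : nat) :
  ((m%:Z + n%:Z) %% 16)%Z \in [:: 0; 2; 8] =
  ((m %% 16 + n %% 16) %% 16 \in [:: 0; 2; 8])%N.
Proof. by rewrite -PoszD modz_nat !inE !eqz_nat modnDm. Qed.

(** Stated as an equality of propositions so that it rewrites below connectives; all congruences are
    expressed through residues modulo 16. *)
Lemma mod4_residue (n c : nat) :
  (n%:Z = c%:Z %[mod 4])%Z = (n %% 16 %% 4 == c %% 4)%N :> Prop.
Proof. apply/propext; rewrite !modz_nat modn_dvdm //; by split=> [[->]|/eqP->]. Qed.

Lemma mod8_residue (n c : nat) :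
  (n%:Z = c%:Z %[mod 8])%Z = (n %% 16 %% 8 == c %% 8)%N :> Prop.
Proof. apply/propext; rewrite !modz_nat modn_dvdm //; by split=> [[->]|/eqP->]. Qed.

Lemma modn4_residue (n c : nat) : (n = c %[mod 4])%N = (n %% 16 %% 4 == c %% 4)%N :> Prop.
Proof. by rewrite -mod4_residue !modz_nat; apply/propext; split=> [->|[]]. Qed.

Lemma modn8_residue (n c : nat) : (n = c %[mod 8])%N = (n %% 16 %% 8 == c %% 8)%N :> Prop.
Proof. by rewrite -mod8_residue !modz_nat; apply/propext; split=> [->|[]]. Qed.

Lemma mod8_opp_residue (n : nat) :
  (- n%:Z = 1 %[mod 8])%Z = (n %% 16 %% 8 == 7)%N :> Prop.
Proof. apply/propext; rewrite modn_dvdm //; by split; lia. Qed.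

(** Adding 16 before subtracting the residues avoids truncated subtraction of natural numbers. *)
Lemma mod16_diff (m n : nat) : ((m%:Z - n%:Z) %% 16)%Z =
  ((16 + m %% 16 - n %% 16) %% 16)%N.
Proof. by lia. Qed.

Lemma mod16_pred (m n : nat) : (m = n %[mod 16])%N ->
  ((-1 + m%:Z) %% 16)%Z = ((15 + n) %% 16)%N.
Proof. by lia. Qed.

(* Here r and s stand for p and q modulo 16, b for (p/q) = 1 and, by reciprocity,
   c for (q/p) = 1. The six conjuncts say that d = 2, p, 2p are not in the Selmer
   group of phi and that d = -1, p, q are not in that of the dual isogeny. *)
Definition local_conditions (r s : nat) (b : bool) : bool :=
  let c := b (+) ((r %% 4 == 3) && (s %% 4 == 3))%N in
  let two x := ((x %% 8 == 1) || (x %% 8 == 7))%N in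
  let minus x := (x %% 4 == 1)%N in
  ([&& ~~ [&& two r, two s & (1 + r * s) %% 16 \in [:: 0; 2; 8]],
      ~~ [&& c, b & (r %% 4 == 1) || (s %% 4 == 1)] &
      ~~ [&& two r == c, two s == b & (r + s) %% 16 \in [:: 0; 2; 8]]] &&
  [&& ~~ [&& minus r, minus s & (r * s %% 8 == 1) || ((15 + r * s) %% 16 \in [:: 0; 4])],
      ~~ [&& minus r == c, b &
          [|| r %% 8 == 1, s %% 8 == 7 | (16 + r - s) %% 16 \in [:: 0; 4]]] &
      ~~ [&& minus s == b, c &
          [|| s %% 8 == 1, r %% 8 == 7 | (16 + s - r) %% 16 \in [:: 0; 4]]]])%N.

Definition stated_conditions (r s : nat) (b : bool) : bool :=
  [|| [&& r %% 4 == 1, s %% 4 == 1, r * s %% 16 == 13 & ~~ b],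
      [&& r %% 4 != s %% 4, r * s %% 8 == 3 & ~~ b],
      [&& r %% 4 == 3, s %% 4 == 3, b, s %% 8 == 3 &
          (16 + r - s) %% 16 \in [:: 8; 12]] |
      [&& r %% 4 == 3, s %% 4 == 3, ~~ b, r %% 8 == 3 &
          (16 + s - r) %% 16 \in [:: 8; 12]]]%N.

Lemma local_conditionsE r s b : (r < 16)%N -> (s < 16)%N -> odd r -> odd s ->
  local_conditions r s b = stated_conditions r s b.
Proof.
have /allP H : all (fun r => all (fun s => all (fun b => odd r ==> odd s ==>
    (local_conditions r s b == stated_conditions r s b)) [:: true; false])
    (iota 0 16)) (iota 0 16) by vm_compute.
move=> r16 s16 ro so; have := H r; rewrite mem_iota => /(_ r16)/allP/(_ s).
rewrite mem_iota => /(_ s16)/allP/(_ b); rewrite ro so => H1.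
by apply/eqP/H1; case: (b).
Qed.

Section Conditions.
Variables (R : realType) (p q : nat).
Hypotheses (pP : prime p) (qP : prime q) (podd : odd p) (qodd : odd q) (pq : p != q).
Local Notation P := (p%:Z).
Local Notation Q := (q%:Z).
Local Notation ES := (@everywhere_soluble R p q).

Lemma local_conditionsP :
  ([/\ ~ ES 2 (2 * (P * Q)), ~ ES P (4 * Q) & ~ ES (2 * P) (2 * Q)] /\
   [/\ ~ ES (-1) (16 * (P * Q)), ~ ES P (16 * - Q) & ~ ES Q (16 * - P)]) <->
  local_conditions (p %% 16) (q %% 16) (qres q p).
Proof.
have qp : q != p by rewrite eq_sym.
(* The set S is symmetric in p and q, so the quartic for d = q is the one for d = p with the primes
   exchanged. *)
have ESsym a b : ES a b <-> @everywhere_soluble R q p a b.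
  by split=> H v vS; apply: H; move: vS; case: v => // l;
    rewrite /in_S !inE; case: (_ == 2%N); rewrite //= orbC.
have pq16 : (p * q = (p %% 16) * (q %% 16) %[mod 16])%N by rewrite modnMm.
have pq8 : (p * q %% 16 %% 8 = (p %% 16) * (q %% 16) %% 8)%N by rewrite pq16 modn_dvdm.
have p2 : ~~ (P %| 2)%Z by rewrite dvdzE /= dvdn_prime2 //; apply: contraL podd => /eqP->.
have q2 : ~~ (Q %| 2)%Z by rewrite dvdzE /= dvdn_prime2 //; apply: contraL qodd => /eqP->.
have pdq : ~~ (P %| Q)%Z by rewrite dvdzE /= dvdn_prime2.
have qdp : ~~ (Q %| P)%Z by rewrite dvdzE /= dvdn_prime2.
have p1 : ~~ (P %| -1)%Z by rewrite dvdzE /= Euclid_dvd1.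
have q1 : ~~ (Q %| -1)%Z by rewrite dvdzE /= Euclid_dvd1.
have nE x : - x = -1 * x :> int by rewrite mulN1r.
have cE : qres p q = qres q p (+) ((p %% 16 %% 4 == 3) && (q %% 16 %% 4 == 3))%N.
  rewrite !modn_dvdm // /qres -!pmulrn [in RHS](quadratic_reciprocity pP qP) //.
  by rewrite addbK.
have p8 : (p %% 8 = p %% 16 %% 8)%N by rewrite modn_dvdm.
have q8 : (q %% 8 = q %% 16 %% 8)%N by rewrite modn_dvdm.
have p4 : (p %% 4 = p %% 16 %% 4)%N by rewrite modn_dvdm.
have q4 : (q %% 4 = q %% 16 %% 4)%N by rewrite modn_dvdm.
set b := qres q p in cE *; pose r := (p %% 16)%N; pose s := (q %% 16)%N.
pose c := b (+) ((r %% 4 == 3) && (s %% 4 == 3))%N.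
pose two (x : nat) := ((x %% 8 == 1) || (x %% 8 == 7))%N.
have A : ES 2 (2 * (P * Q)) <->
    [&& two r, two s & (1 + r * s) %% 16 \in [:: 0; 2; 8]]%N.
  rewrite (soluble_2_2pq R pP qP podd qodd pq) !qres2 // p8 q8 -PoszM.
  by rewrite (mod16_two_square pq16); split=> /and3P.
have B : ES P (4 * Q) <-> [&& c, b & (r %% 4 == 1) || (s %% 4 == 1)]%N.
  rewrite (soluble_p_4q R pP qP podd qodd pq) cE (mod4_residue p 1) (mod4_residue q 1).
  by split=> [[h1 h2 /orP h3]|/and3P[h1 h2 /orP h3]]; first apply/and3P.
have C : ES (2 * P) (2 * Q) <->
    [&& two r == c, two s == b & (r + s) %% 16 \in [:: 0; 2; 8]]%N.
  rewrite (soluble_2p_2q R pP qP podd qodd pq) !qresM // !qres2 // cE p8 q8.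
  by rewrite mod16_sum_two_square; split=> /and3P.
have D : ES (-1) (16 * (P * Q)) <->
    [&& r %% 4 == 1, s %% 4 == 1 &
        (r * s %% 8 == 1) || ((15 + r * s) %% 16 \in [:: 0; 4])]%N.
  rewrite (soluble_N1_16pq R pP qP podd qodd pq) !qresN1 // p4 q4 -PoszM.
  rewrite (mod16_pred pq16) (mod8_residue _ 1) pq8 !inE !eqz_nat.
  by split=> [[h1 h2 /orP h3]|/and3P[h1 h2 /orP h3]]; first apply/and3P.
have E : ES P (16 * - Q) <-> [&& (r %% 4 == 1) == c, b &
    [|| r %% 8 == 1, s %% 8 == 7 | (16 + r - s) %% 16 \in [:: 0; 4]]]%N.
  rewrite (soluble_p_N16q R pP qP podd qodd pq) nE qresM // qresN1 // cE p4.
  rewrite -nE (mod8_residue _ 1) mod8_opp_residue mod16_diff !inE !eqz_nat.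
  by split=> [[h1 h2 /or3P h3]|/and3P[h1 h2 /or3P h3]]; first apply/and3P.
have F : ES Q (16 * - P) <-> [&& (s %% 4 == 1) == b, c &
    [|| s %% 8 == 1, r %% 8 == 7 | (16 + s - r) %% 16 \in [:: 0; 4]]]%N.
  rewrite ESsym (soluble_p_N16q R qP pP qodd podd qp) nE qresM // qresN1 // cE q4.
  rewrite -nE (mod8_residue _ 1) mod8_opp_residue mod16_diff !inE !eqz_nat.
  by split=> [[h1 h2 /or3P h3]|/and3P[h1 h2 /or3P h3]]; first apply/and3P.
rewrite /local_conditions -/r -/s -/c; split.
  case=> -[nA nB nC] [nD nE' nF]; apply/andP; split; apply/and3P; split; apply/negP.
  - by move/A.
  - by move/B.
  - by move/C.
  - by move/D.
  - by move/E.
  - by move/F.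
by case/andP=> /and3P[nA nB nC] /and3P[nD nE' nF]; split; split;
  [move/A; apply/negP|move/B; apply/negP|move/C; apply/negP|
   move/D; apply/negP|move/E; apply/negP|move/F; apply/negP].
Qed.

Lemma stated_conditionsP :
  [\/ [/\ (p = 1 %[mod 4])%N, (q = 1 %[mod 4])%N, (p * q = 13 %[mod 16])%N
        & legendre p q = -1],
      [/\ (p <> q %[mod 4])%N, (p * q = 3 %[mod 8])%N & legendre p q = -1],
      [/\ (p = 3 %[mod 4])%N /\ (q = 3 %[mod 4])%N, legendre p q = 1,
          (q = 3 %[mod 8])%N
        & (p%:Z - q%:Z = 8 %[mod 16])%Z \/ (p%:Z - q%:Z = 12 %[mod 16])%Z]
    | [/\ (p = 3 %[mod 4])%N /\ (q = 3 %[mod 4])%N, legendre p q = -1,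
          (p = 3 %[mod 8])%N
        & (q%:Z - p%:Z = 8 %[mod 16])%Z \/ (q%:Z - p%:Z = 12 %[mod 16])%Z]] <->
  stated_conditions (p %% 16) (q %% 16) (qres q p).
Proof.
have qp : ~~ (q %| p)%N by rewrite dvdn_prime2 // eq_sym.
have legN1 : (legendre p q = -1) = ~~ qres q p :> Prop.
  by rewrite legendreE //; apply/propext; case: (qres q p).
have leg1 : (legendre p q = 1) = qres q p :> Prop.
  by rewrite legendreE //; apply/propext; case: (qres q p).
have pq16 c : (p * q = c %[mod 16])%N = (p %% 16 * (q %% 16) %% 16 == c %% 16)%N :> Prop.
  by rewrite modnMm; apply/propext; split=> /eqP.
have pq8 c : (p * q = c %[mod 8])%N = (p %% 16 * (q %% 16) %% 8 == c %% 8)%N :> Prop.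
  rewrite -[in RHS]modnMm !modn_dvdm // modnMm.
  by apply/propext; split=> /eqP.
have neq4 : (p <> q %[mod 4])%N = (p %% 16 %% 4 != q %% 16 %% 4)%N :> Prop.
  by rewrite !modn_dvdm //; apply/propext; split=> [/eqP|/eqP].
have diff (m n : nat) : ((m%:Z - n%:Z = 8 %[mod 16])%Z \/ (m%:Z - n%:Z = 12 %[mod 16])%Z) =
    ((16 + m %% 16 - n %% 16) %% 16 \in [:: 8; 12])%N :> Prop.
  rewrite !mod16_diff !inE; apply/propext.
  by split=> [[] [->]|/orP[] /eqP->] //; [left|right].
rewrite legN1 leg1 !diff pq16 pq8 neq4 !modn4_residue !modn8_residue /stated_conditions.
split=> [[[-> -> -> ->]|[-> -> ->]|[[-> ->] -> -> ->]|[[-> ->] -> -> ->]]|];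
  rewrite ?orbT //.
case/or4P=> [/and4P[]|/and3P[]|/and5P[]|/and5P[]] *;
  by [constructor 1|constructor 2|constructor 3|constructor 4].
Qed.

End Conditions.

Local Open Scope classical_set_scope.

Theorem theorem1p1 (R : realType) (p q : nat)
    (p_prime : prime p) (q_prime : prime q)
    (p_odd : odd p) (q_odd : odd q) (p_neq_q : p <> q) :
  (selmer_phi R p q = [set sqclass_of 1; sqclass_of (p * q)%:R] /\
   selmer_phihat R p q = [set sqclass_of 1; sqclass_of (- (p * q)%:R)])
  <->
  [\/ [/\ (p = 1 %[mod 4])%N, (q = 1 %[mod 4])%N, (p * q = 13 %[mod 16])%N
        & legendre p q = -1],
      [/\ (p <> q %[mod 4])%N, (p * q = 3 %[mod 8])%N & legendre p q = -1],
      [/\ (p = 3 %[mod 4])%N /\ (q = 3 %[mod 4])%N, legendre p q = 1,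
          (q = 3 %[mod 8])%N
        & (p%:Z - q%:Z = 8 %[mod 16])%Z \/ (p%:Z - q%:Z = 12 %[mod 16])%Z]
    | [/\ (p = 3 %[mod 4])%N /\ (q = 3 %[mod 4])%N, legendre p q = -1,
          (p = 3 %[mod 8])%N
        & (q%:Z - p%:Z = 8 %[mod 16])%Z \/ (q%:Z - p%:Z = 12 %[mod 16])%Z]].
Proof.
have pq : p != q by apply/eqP.
rewrite (selmer_phi_trivial R p_prime q_prime p_odd q_odd pq).
rewrite (selmer_phihat_trivial R p_prime q_prime p_odd q_odd pq).
rewrite (local_conditionsP R p_prime q_prime p_odd q_odd pq).
rewrite (stated_conditionsP p_prime q_prime pq).
by rewrite local_conditionsE ?ltn_mod ?odd_mod.
Qed.
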